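(* Let $k$ be an algebraically closed field, $R$ a finite dimensional $k$-algebra, $G$ a finite abelian group whose order is prime to the characteristic of $k$, and $\tau:G\to\mathrm{Aut}_{k\text{-alg}}(R)$ a group homomorphism. Suppose that for some simple $R$-module $V$ the modules ${}^gV$ ($g\in G$) form a complete set of pairwise non-isomorphic simple $R$-modules, and let $t=\dim_kV$. Let $S=E^{\mathrm{op}}$ be the associated basic algebra with its $G$-action $\tilde\tau$, so that $R\cong\mathrm{Mat}_t(S)$, and let $S_1=\{s\in S:\tilde\tau(g)(s)=s\text{ for all }g\in G\}$. Then there is an isomorphism $S\cong S_1\ast G$ with a skew group ring of $G$ over $S_1$, and $S_1$ is scalar local. Thus $R\cong\mathrm{Mat}_t(S_1\ast G)\cong\mathrm{Mat}_t(S_1)\ast G$.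
   Context: For an $R$-module $M$ and $g\in G$, ${}^gM$ is the $R$-module with underlying group $M$ and action $r\cdot m=\tau(g)^{-1}(r)m$. Let $P$ be a projective cover of $V$, $Q=\bigoplus_{g\in G}{}^gP$ (a projective generator of $R$-mod) and $E=\mathrm{End}_R(Q)$. Regarding elements of $Q$ as $G$-indexed tuples of elements of $P$, let $\psi_g:Q\to Q$ be the additive bijection moving the entry in position $h$ to position $gh$. Then $\tilde\tau(g)(\phi)=\psi_g\circ\phi\circ\psi_g^{-1}$ defines an action of $G$ by $k$-algebra automorphisms on $E^{\mathrm{op}}$. $S=E^{\mathrm{op}}$ is a basic algebra on which $G$ permutes simply transitively the primitive idempotents given by the projections onto the summands ${}^gP$. A finite dimensional $k$-algebra $A$ is scalar local if it is local with $A/J(A)\cong k$, $J(A)$ being the Jacobson radical. A skew group ring $A\ast G$, for an action of $G$ on $A$ by algebra automorphisms, is the free left $A$-module on $G$ with multiplication extending those of $A$ and $G$ by $s^g g=gs$ ($s\in A$, $g\in G$), where $s^g$ denotes the image of $s$ under the action of $g$. Here the theorem asserts the isomorphisms for some action of $G$ on $S_1$ and on $\mathrm{Mat}_t(S_1)$. *)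

(* Defs.v *)
From HB Require Import structures.
From mathcomp Require Import all_boot all_order all_algebra all_fingroup all_field.
From mathcomp Require Import boolp.

Set Implicit Arguments.
Unset Strict Implicit.
Unset Printing Implicit Defensive.

Import GRing.Theory.
Local Open Scope ring_scope.

Section Modules.
Variable R : nzRingType.

Definition mod_iso (M N : lmodType R) : Prop :=
  exists f : {linear M -> N}, bijective f.

Definition simple_mod (M : lmodType R) : Prop :=
  (exists x : M, x != 0) /\
  forall N : {pred M}, submod_closed N -> N =i pred1 0 \/ N =i predT.

Definition complete_simples (I : Type) (M : I -> lmodType R) : Prop :=
  [/\ forall i, simple_mod (M i),
      forall i j, mod_iso (M i) (M j) -> i = j
    & forall W : lmodType R, simple_mod W -> exists i, mod_iso W (M i)].

Definition surjective (A B : Type) (f : A -> B) : Prop :=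
  forall b, exists a, f a = b.

Definition projective (P : lmodType R) : Prop :=
  forall (M N : lmodType R) (f : {linear M -> N}) (h : {linear P -> N}),
    surjective f -> exists l : {linear P -> M}, f \o l =1 h.

Definition superfluous (M : lmodType R) (N : {pred M}) : Prop :=
  forall L : {pred M}, submod_closed L ->
    (forall m, exists x y, [/\ x \in N, y \in L & m = x + y]) -> L =i predT.

Definition projective_cover (V P : lmodType R) (p : {linear P -> V}) : Prop :=
  [/\ projective P, surjective p & superfluous [pred x | p x == 0]].

End Modules.

Definition has_dim (k : nzRingType) (n : nat) (V : lmodType k) : Prop :=
  inhabited (Vector.axiom n V).

Section Restriction.
Variables (k : nzRingType) (R : lalgType k).

(* Restriction of scalars along k -> R. *)
Definition restr (V : lmodType R) : Type := V.
Variable V : lmodType R.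
HB.instance Definition _ := GRing.Zmodule.on (restr V).
Definition restr_scale (c : k) (v : restr V) : restr V := (c%:A : R) *: (v : V).
Fact restr_scaleA a b v :
  restr_scale a (restr_scale b v) = restr_scale (a * b) v.
Proof. by rewrite /restr_scale scalerA -scalerAl mul1r scalerA. Qed.
Fact restr_scale1 : left_id 1 restr_scale.
Proof. by move=> v; rewrite /restr_scale !scale1r. Qed.
Fact restr_scaleDr : right_distributive restr_scale +%R.
Proof. by move=> a u v; rewrite /restr_scale scalerDr. Qed.
Fact restr_scaleDl v : {morph restr_scale^~ v : a b / a + b}.
Proof. by move=> a b; rewrite /restr_scale !scalerDl. Qed.
HB.instance Definition _ := GRing.Zmodule_isLmodule.Build k (restr V)
  restr_scaleA restr_scale1 restr_scaleDr restr_scaleDl.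
End Restriction.

Definition alg_iso (k : nzRingType) (A B : algType k) : Prop :=
  exists f : {lrmorphism A -> B}, bijective f.

Section ScalarLocal.
Variables (k : fieldType) (A : algType k).

(* The submodules of the regular module A^o are the left ideals of A. *)
Definition left_ideal (I : {pred A}) : Prop := submod_closed (I : {pred A^o}).

Definition maximal_left_ideal (I : {pred A}) : Prop :=
  [/\ left_ideal I, ~ (I =i predT)
    & forall J : {pred A}, left_ideal J -> {subset I <= J} ->
        J =i I \/ J =i predT].

Definition is_local : Prop :=
  exists2 I : {pred A}, maximal_left_ideal I
    & forall J : {pred A}, maximal_left_ideal J -> J =i I.

Definition jacobson (a : A) : Prop :=
  forall I : {pred A}, maximal_left_ideal I -> a \in I.

(* A / J(A) is isomorphic to k: there is a surjective k-algebra morphism from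
   A to k with kernel J(A). *)
Definition residue_iso_base : Prop :=
  exists f : {lrmorphism A -> k^o},
    surjective f /\ forall a, f a = 0 <-> jacobson a.

Definition scalar_local : Prop :=
  [/\ exists n, has_dim n A, is_local & residue_iso_base].

End ScalarLocal.

(* The opposite algebra; A^c is only a ring in the library. *)
Section Opposite.
Variables (k : nzRingType) (A : algType k).
Fact opp_scaleA (a b : k) (v : A^c) : a *: (b *: (v : A)) = (a * b) *: (v : A).
Proof. exact: scalerA. Qed.
HB.instance Definition _ := GRing.Zmodule_isLmodule.Build k A^c
  opp_scaleA (@scale1r k A) (@scalerDr k A) (fun v a b => @scalerDl k A v a b).
Fact opp_scalerAl (a : k) (u v : A^c) : a *: (u * v) = (a *: u) * v.
Proof. exact: (@scalerAr k A a v u). Qed.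
HB.instance Definition _ := GRing.Lmodule_isLalgebra.Build k A^c opp_scalerAl.
Fact opp_scalerAr (a : k) (u v : A^c) : a *: (u * v) = u * (a *: v).
Proof. exact: (@scalerAl k A a v u). Qed.
HB.instance Definition _ := GRing.Lalgebra_isAlgebra.Build k A^c opp_scalerAr.
End Opposite.

(* The k-algebra Mat_(n+1)(A).  The index is shifted because library algebras
   are nonzero; the type is renamed because the canonical scalars of 'M[A]_n
   are those of A, not those of k. *)
Section MatrixAlgebra.
Variables (k : nzRingType) (A : algType k) (n : nat).
Definition matalg : Type := 'M[A]_n.+1.
HB.instance Definition _ := GRing.NzRing.on matalg.
Definition matalg_scale (c : k) (M : matalg) : matalg :=
  map_mx (fun x : A => c *: x) M.
Fact matalg_scaleA a b v :
  matalg_scale a (matalg_scale b v) = matalg_scale (a * b) v.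
Proof. by apply/matrixP=> i j; rewrite !mxE scalerA. Qed.
Fact matalg_scale1 : left_id 1 matalg_scale.
Proof. by move=> v; apply/matrixP=> i j; rewrite !mxE scale1r. Qed.
Fact matalg_scaleDr : right_distributive matalg_scale +%R.
Proof. by move=> a u v; apply/matrixP=> i j; rewrite !mxE scalerDr. Qed.
Fact matalg_scaleDl v : {morph matalg_scale^~ v : a b / a + b}.
Proof. by move=> a b; apply/matrixP=> i j; rewrite !mxE scalerDl. Qed.
HB.instance Definition _ := GRing.Zmodule_isLmodule.Build k matalg
  matalg_scaleA matalg_scale1 matalg_scaleDr matalg_scaleDl.
Fact matalg_scalerAl (a : k) (u v : matalg) : a *: (u * v) = (a *: u) * v.
Proof.
apply/matrixP=> i j; rewrite !mxE scaler_sumr; apply: eq_bigr => l _.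
by rewrite !mxE scalerAl.
Qed.
HB.instance Definition _ :=
  GRing.Lmodule_isLalgebra.Build k matalg matalg_scalerAl.
Fact matalg_scalerAr (a : k) (u v : matalg) : a *: (u * v) = u * (a *: v).
Proof.
apply/matrixP=> i j; rewrite !mxE scaler_sumr; apply: eq_bigr => l _.
by rewrite !mxE scalerAr.
Qed.
HB.instance Definition _ :=
  GRing.Lalgebra_isAlgebra.Build k matalg matalg_scalerAr.
End MatrixAlgebra.

(* A group homomorphism from gT to the k-algebra automorphisms of A; each
   [act g] is bijective, with inverse [act g^-1]. *)
Record algaction (k : nzRingType) (gT : finGroupType) (A : algType k) :=
  AlgAction {
    act :> gT -> {lrmorphism A -> A};
    act_id : forall a, act 1%g a = a;
    act_mul : forall g h a, act (g * h)%g a = act g (act h a)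
  }.

Section ActionTheory.
Variables (k : nzRingType) (gT : finGroupType) (A : algType k).
Variable alpha : algaction gT A.
Lemma actK g : cancel (alpha g) (alpha g^-1%g).
Proof. by move=> a; rewrite -act_mul mulVg act_id. Qed.
Lemma actVK g : cancel (alpha g^-1%g) (alpha g).
Proof. by move=> a; rewrite -act_mul mulgV act_id. Qed.
Lemma act_bij g : bijective (alpha g).
Proof. exact: Bijective (actK g) (actVK g). Qed.

Definition fixed_pred : {pred A} := [pred s | [forall g, alpha g s == s]].
Fact fixed_subalg : subalg_closed fixed_pred.
Proof.
split=> [|a u v|u v]; rewrite !inE.
- by apply/forallP=> g; rewrite rmorph1.
- move=> /forallP fu /forallP fv; apply/forallP=> g.
  by rewrite linearP /= (eqP (fu g)) (eqP (fv g)).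
- move=> /forallP fu /forallP fv; apply/forallP=> g.
  by rewrite rmorphM /= (eqP (fu g)) (eqP (fv g)).
Qed.
HB.instance Definition _ := GRing.isSubalgClosed.Build k A fixed_pred
  fixed_subalg.
Record fixalg : Type := FixAlg { fixval :> A; _ : fixval \in fixed_pred }.
HB.instance Definition _ := [isSub for fixval].
HB.instance Definition _ := [Choice of fixalg by <:].
HB.instance Definition _ := [SubChoice_isSubAlgebra of fixalg by <:].

(* The skew group ring A * G.  The element x stands for \sum_g (x g) g; since
   g s = (alpha g s) g, the coefficient of m in x * y is
   \sum_g x g * alpha g (y (g^-1 m)). *)
Definition skew_group & algaction gT A : Type := {ffun gT -> A}.
Local Notation AG := (skew_group alpha).
HB.instance Definition _ := GRing.Lmodule.on AG.
Definition skew_one : AG := [ffun g => (g == 1%g)%:R].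
Definition skew_mul (x y : AG) : AG :=
  [ffun m => \sum_g x g * alpha g (y (g^-1 * m)%g)].
Fact skew_mulA : associative skew_mul.
Proof.
move=> x y z; apply/ffunP=> m; rewrite !ffunE.
under eq_bigr => g _ do rewrite ffunE raddf_sum mulr_sumr.
under [RHS]eq_bigr => h _ do rewrite ffunE mulr_suml.
rewrite [RHS]exchange_big /=; apply: eq_bigr => g _.
rewrite [RHS](reindex_inj (mulgI g)) /=; apply: eq_bigr => h _.
by rewrite mulKg rmorphM /= -act_mul invMg !mulgA mulrA.
Qed.
Fact skew_mul1x : left_id skew_one skew_mul.
Proof.
move=> x; apply/ffunP=> m; rewrite ffunE (bigD1 1%g) //= big1 => [|g ng1].
  by rewrite ffunE eqxx mul1r act_id invg1 mul1g addr0.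
by rewrite ffunE (negbTE ng1) mul0r.
Qed.
Fact skew_mulx1 : right_id skew_one skew_mul.
Proof.
move=> x; apply/ffunP=> m; rewrite ffunE (bigD1 m) //= big1 => [|g ngm].
  by rewrite ffunE mulVg eqxx rmorph1 mulr1 addr0.
by rewrite ffunE -eq_mulVg1 (negbTE ngm) rmorph0 mulr0.
Qed.
Fact skew_mulDl : left_distributive skew_mul +%R.
Proof.
move=> x y z; apply/ffunP=> m; rewrite !ffunE -big_split /=.
by apply: eq_bigr => g _; rewrite ffunE mulrDl.
Qed.
Fact skew_mulDr : right_distributive skew_mul +%R.
Proof.
move=> x y z; apply/ffunP=> m; rewrite !ffunE -big_split /=.
by apply: eq_bigr => g _; rewrite ffunE rmorphD mulrDr.
Qed.
Fact skew_1neq0 : skew_one != 0.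
Proof.
by apply/eqP=> /ffunP/(_ 1%g)/eqP; rewrite !ffunE eqxx oner_eq0.
Qed.
HB.instance Definition _ := GRing.Zmodule_isNzRing.Build AG
  skew_mulA skew_mul1x skew_mulx1 skew_mulDl skew_mulDr skew_1neq0.
Fact skew_scalerAl (a : k) (u v : AG) : a *: (u * v) = (a *: u) * v.
Proof.
apply/ffunP=> m; rewrite !ffunE scaler_sumr; apply: eq_bigr => g _.
by rewrite ffunE scalerAl.
Qed.
HB.instance Definition _ := GRing.Lmodule_isLalgebra.Build k AG skew_scalerAl.
Fact skew_scalerAr (a : k) (u v : AG) : a *: (u * v) = u * (a *: v).
Proof.
apply/ffunP=> m; rewrite !ffunE scaler_sumr; apply: eq_bigr => g _.
by rewrite ffunE linearZ scalerAr.
Qed.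
HB.instance Definition _ := GRing.Lalgebra_isAlgebra.Build k AG skew_scalerAr.
End ActionTheory.

Section Endomorphisms.
Variables (k : nzRingType) (R : algType k) (M : lmodType R).
Hypothesis M_neq0 : exists x : M, x != 0.

(* End_R(M); the argument M_neq0 makes 1 <> 0 provable. *)
Definition endalg & (exists x : M, x != 0) : Type := {linear M -> M}.
Local Notation E := (endalg M_neq0).

Definition endfun (f : E) : {linear M -> M} := f.

Lemma endP (f g : E) : endfun f =1 endfun g -> f = g.
Proof.
case: f => f [[f1] [f2]]; case: g => g [[g1] [g2]] /= /funext fg.
move: f1 f2; rewrite fg => f1 f2.
by rewrite (Prop_irrelevance f1 g1) (Prop_irrelevance f2 g2).
Qed.

HB.instance Definition _ := gen_eqMixin E.
HB.instance Definition _ := gen_choiceMixin E.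

Definition end_zero : E := (\0 : {linear M -> M}).
Definition end_opp (f : E) : E := (\- (endfun f) : {linear M -> M}).
Definition end_add (f g : E) : E := (endfun f \+ endfun g : {linear M -> M}).
Definition end_one : E := (idfun : {linear M -> M}).
Definition end_mul (f g : E) : E := (endfun f \o endfun g : {linear M -> M}).

Fact end_addA : associative end_add.
Proof. by move=> f g h; apply: endP => x /=; rewrite addrA. Qed.
Fact end_addC : commutative end_add.
Proof. by move=> f g; apply: endP => x /=; rewrite addrC. Qed.
Fact end_add0 : left_id end_zero end_add.
Proof. by move=> f; apply: endP => x /=; rewrite add0r. Qed.
Fact end_addN : left_inverse end_zero end_opp end_add.
Proof. by move=> f; apply: endP => x /=; rewrite addNr. Qed.
HB.instance Definition _ :=
  GRing.isZmodule.Build E end_addA end_addC end_add0 end_addN.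

Fact end_mulA : associative end_mul.
Proof. by move=> f g h; apply: endP. Qed.
Fact end_mul1f : left_id end_one end_mul.
Proof. by move=> f; apply: endP. Qed.
Fact end_mulf1 : right_id end_one end_mul.
Proof. by move=> f; apply: endP. Qed.
Fact end_mulDl : left_distributive end_mul end_add.
Proof. by move=> f g h; apply: endP. Qed.
Fact end_mulDr : right_distributive end_mul end_add.
Proof. by move=> f g h; apply: endP => x /=; rewrite raddfD. Qed.
Fact end_1neq0 : end_one != 0.
Proof.
case: M_neq0 => x /eqP x0; apply/eqP => /(congr1 (fun f : E => endfun f x)).
exact: x0.
Qed.
HB.instance Definition _ := GRing.Zmodule_isNzRing.Build E
  end_mulA end_mul1f end_mulf1 end_mulDl end_mulDr end_1neq0.

Definition end_scale_fun (c : k) (f : E) (x : M) : M :=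
  (c%:A : R) *: endfun f x.
Fact end_scale_linear c f : linear (end_scale_fun c f).
Proof.
move=> r u v; rewrite /end_scale_fun linearP scalerDr !scalerA.
by rewrite -scalerAl -scalerAr mul1r mulr1.
Qed.
HB.instance Definition _ c f :=
  GRing.isLinear.Build R M M *:%R (end_scale_fun c f) (end_scale_linear c f).
Definition end_scale (c : k) (f : E) : E :=
  (end_scale_fun c f : {linear M -> M}).
Fact end_scaleA a b v : end_scale a (end_scale b v) = end_scale (a * b) v.
Proof.
apply: endP => x; rewrite /= /end_scale_fun /= /end_scale_fun.
by rewrite scalerA -scalerAl mul1r scalerA.
Qed.
Fact end_scale1 : left_id 1 end_scale.
Proof. by move=> f; apply: endP => x; rewrite /= /end_scale_fun !scale1r. Qed.
Fact end_scaleDr : right_distributive end_scale +%R.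
Proof. by move=> a f g; apply: endP => x; rewrite /= /end_scale_fun scalerDr. Qed.
Fact end_scaleDl v : {morph end_scale^~ v : a b / a + b}.
Proof. by move=> a b; apply: endP => x; rewrite /= /end_scale_fun !scalerDl. Qed.
HB.instance Definition _ := GRing.Zmodule_isLmodule.Build k E
  end_scaleA end_scale1 end_scaleDr end_scaleDl.
Fact end_scalerAl (a : k) (u v : E) : a *: (u * v) = (a *: u) * v.
Proof. by apply: endP. Qed.
HB.instance Definition _ := GRing.Lmodule_isLalgebra.Build k E end_scalerAl.
Fact end_scalerAr (a : k) (u v : E) : a *: (u * v) = u * (a *: v).
Proof. by apply: endP => x; rewrite /= /end_scale_fun /= linearZ. Qed.
HB.instance Definition _ := GRing.Lalgebra_isAlgebra.Build k E end_scalerAr.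
End Endomorphisms.

Section Twist.
Variables (k : nzRingType) (gT : finGroupType) (R : algType k).

(* The module gM: r acts on M as tau(g)^-1 (r). *)
Definition twist (_ : algaction gT R) (_ : gT) (M : lmodType R) : Type := M.

Variable tau : algaction gT R.

Section TwistInstances.
Variables (g : gT) (M : lmodType R).
Local Notation gM := (twist tau g M).
HB.instance Definition _ := GRing.Zmodule.on gM.
Definition twist_scale (r : R) (m : gM) : gM := tau g^-1%g r *: (m : M).
Fact twist_scaleA a b v :
  twist_scale a (twist_scale b v) = twist_scale (a * b) v.
Proof. by rewrite /twist_scale scalerA rmorphM. Qed.
Fact twist_scale1 : left_id 1 twist_scale.
Proof. by move=> v; rewrite /twist_scale rmorph1 scale1r. Qed.
Fact twist_scaleDr : right_distributive twist_scale +%R.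
Proof. by move=> a u v; rewrite /twist_scale scalerDr. Qed.
Fact twist_scaleDl v : {morph twist_scale^~ v : a b / a + b}.
Proof. by move=> a b; rewrite /twist_scale rmorphD scalerDl. Qed.
HB.instance Definition _ := GRing.Zmodule_isLmodule.Build R gM
  twist_scaleA twist_scale1 twist_scaleDr twist_scaleDl.
End TwistInstances.

(* The direct sum of the modules gP, as gT-indexed tuples of elements of P. *)
Definition twist_sum (_ : algaction gT R) (P : lmodType R) : Type :=
  {ffun gT -> P}.

Variable P : lmodType R.
Local Notation Q := (twist_sum tau P).
HB.instance Definition _ := GRing.Zmodule.on Q.
Definition sum_scale (r : R) (q : Q) : Q :=
  [ffun g => r *: (q g : twist tau g P)].
Fact sum_scaleA a b v : sum_scale a (sum_scale b v) = sum_scale (a * b) v.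
Proof. by apply/ffunP=> g; rewrite !ffunE scalerA. Qed.
Fact sum_scale1 : left_id 1 sum_scale.
Proof. by move=> v; apply/ffunP=> g; rewrite !ffunE scale1r. Qed.
Fact sum_scaleDr : right_distributive sum_scale +%R.
Proof.
by move=> a u v; apply/ffunP=> g; rewrite !ffunE (@scalerDr R (twist tau g P)).
Qed.
Fact sum_scaleDl v : {morph sum_scale^~ v : a b / a + b}.
Proof. by move=> a b; apply/ffunP=> g; rewrite !ffunE scalerDl. Qed.
HB.instance Definition _ := GRing.Zmodule_isLmodule.Build R Q
  sum_scaleA sum_scale1 sum_scaleDr sum_scaleDl.

Definition psi (g : gT) (q : Q) : Q := [ffun h => q (g^-1 * h)%g].

Lemma psiK g : cancel (psi g) (psi g^-1%g).
Proof. by move=> q; apply/ffunP=> h; rewrite !ffunE invgK mulKg. Qed.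
Lemma psiVK g : cancel (psi g^-1%g) (psi g).
Proof. by move=> q; apply/ffunP=> h; rewrite !ffunE invgK mulKVg. Qed.
Lemma psi_semilinear g r u v :
  psi g (r *: u + v) = tau g r *: psi g u + psi g v.
Proof.
apply/ffunP=> h; rewrite !ffunE; congr (_ + _).
rewrite /GRing.scale /= /twist_scale; congr (_ *: _).
by rewrite invMg invgK act_mul.
Qed.

Hypothesis P_neq0 : exists x : P, x != 0.

Lemma twist_sum_neq0 : exists q : Q, q != 0.
Proof.
case: P_neq0 => x x0; exists ([ffun=> x] : {ffun gT -> P}).
by apply: contraNneq x0 => /ffunP/(_ 1%g); rewrite !ffunE => ->.
Qed.

Definition basic_alg : algType k := (endalg twist_sum_neq0)^c.
Local Notation S := basic_alg.

Section Conjugation.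
Variable g : gT.
Definition psi_conj_fun (phi : endalg twist_sum_neq0) : Q -> Q :=
  psi g \o endfun phi \o psi g^-1%g.
Fact psi_conj_linear phi : linear (psi_conj_fun phi).
Proof.
move=> r u v; rewrite /psi_conj_fun /= psi_semilinear linearP psi_semilinear.
by rewrite actVK.
Qed.
HB.instance Definition _ phi :=
  GRing.isLinear.Build R Q Q *:%R (psi_conj_fun phi) (psi_conj_linear phi).
Definition psi_conj (phi : S) : S := (psi_conj_fun phi : {linear Q -> Q}).

Fact psi_conj_zmod : zmod_morphism psi_conj.
Proof.
move=> a b; apply: endP => q; rewrite /= /psi_conj_fun /=.
by apply/ffunP=> h; rewrite !ffunE.
Qed.
Fact psi_conj_monoid : monoid_morphism psi_conj.
Proof.
split; first by apply: endP => q; rewrite /= /psi_conj_fun /= psiVK.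
by move=> a b; apply: endP => q; rewrite /= /psi_conj_fun /= psiK.
Qed.
Fact psi_conj_scalable : scalable psi_conj.
Proof.
move=> c a; apply: endP => q; rewrite /= /psi_conj_fun /= /end_scale_fun /=.
rewrite -[X in psi g X]addr0 psi_semilinear linearZ rmorph1.
have -> : psi g 0 = 0 by apply/ffunP=> h; rewrite !ffunE.
by rewrite addr0.
Qed.
HB.instance Definition _ :=
  GRing.isZmodMorphism.Build S S psi_conj psi_conj_zmod.
HB.instance Definition _ :=
  GRing.isMonoidMorphism.Build S S psi_conj psi_conj_monoid.
HB.instance Definition _ :=
  GRing.isScalable.Build k S S *:%R psi_conj psi_conj_scalable.
End Conjugation.

Fact psi_conj_id (a : S) : psi_conj 1%g a = a.
Proof.
apply: endP => q; rewrite /= /psi_conj_fun /=.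
have psi1 x : psi 1%g x = x by apply/ffunP=> h; rewrite !ffunE invg1 mul1g.
by rewrite psi1 invg1 psi1.
Qed.
Fact psi_conj_mul g h (a : S) : psi_conj (g * h)%g a = psi_conj g (psi_conj h a).
Proof.
apply: endP => q; rewrite /= /psi_conj_fun /=.
have psiM x y z : psi (x * y)%g z = psi x (psi y z).
  by apply/ffunP=> m; rewrite !ffunE invMg mulgA.
by rewrite invMg !psiM.
Qed.

Definition basic_action : algaction gT S :=
  @AlgAction k gT S (fun g => psi_conj g : {lrmorphism S -> S})
    psi_conj_id psi_conj_mul.

End Twist.

Lemma projective_cover_neq0 (R : nzRingType) (V P : lmodType R)
    (p : {linear P -> V}) :
  simple_mod V -> projective_cover p -> exists x : P, x != 0.
Proof.
move=> [[v v0] _] [_ /(_ v)[x px] _]; exists x.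
by apply: contraNneq v0 => x0; rewrite -px x0 linear0.
Qed.

(* Main.v *)
Require Import Defs.
From HB Require Import structures.
From mathcomp Require Import all_boot all_order all_algebra all_fingroup.
From mathcomp Require Import all_solvable all_field boolp.

Set Implicit Arguments.
Unset Strict Implicit.
Unset Printing Implicit Defensive.

Import GRing.Theory VectorInternalTheory.
Local Open Scope ring_scope.

(**
The group [G] permutes the projections [e_g] of [Q] onto its summands simply
transitively.  Since [G] is abelian and its order is invertible in the
algebraically closed field [k], it is self-dual: there is a symmetric
nondegenerate bicharacter [chi : G * G -> k].  The elements [u_g = \sum_h chi
(g^-1) h *: e_h] form a group of units of [S] isomorphic to [G], and [u_g] is
an eigenvector of [G] with character [chi g].  Hence [S] is the direct sum of
its isotypic parts [S_1 * u_g], and [G] acts on [S_1] through conjugation by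
the [u_g].

An element of [S_1] induces on [Q / ker = \bigoplus_g (gV)] an endomorphism
which is diagonal, because the twists [gV] are pairwise non-isomorphic, and
[G]-invariant, hence a scalar by Schur's lemma.  This gives an algebra
morphism [S_1 -> k].  If the scalar is nonzero, the endomorphism is surjective
because [ker] is superfluous, and it splits because [Q] is projective; the
section has the same property, so both are invertible.  Thus [S_1] is scalar
local.

Finally, let [w] in [Q^t] have coordinates lifting a basis of [V].  By the
density theorem [r |-> r *: w] is surjective modulo the superfluous kernel of
[Q^t -> \bigoplus_g (gV)^t], hence surjective, and it splits.  Its kernel is
contained in the annihilator of all simple modules, which is superfluous in
[R]. So [R] is isomorphic to [Q^t] as a module, and taking endomorphism rings
gives [R ~ Mat_t(S)].
*)

(** * Algebra isomorphisms and matrix algebras *)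

Lemma alg_isoI (k : nzRingType) (A B : algType k) (f : A -> B) (g : B -> A) :
  zmod_morphism f -> monoid_morphism f -> scalable f ->
  cancel f g -> cancel g f -> alg_iso A B.
Proof.
move=> fB fM fZ fK gK.
pose aB := GRing.isZmodMorphism.Build A B f fB.
pose aM := GRing.isMonoidMorphism.Build A B f fM.
pose aZ := GRing.isScalable.Build k A B *:%R f fZ.
pose F : {lrmorphism A -> B} := HB.pack f aB aM aZ.
by exists F, g.
Qed.

Lemma alg_iso_sym (k : nzRingType) (A B : algType k) :
  alg_iso A B -> alg_iso B A.
Proof.
move=> [f [g fK gK]]; apply: (@alg_isoI _ _ _ g f) => //.
- by move=> x y; apply: (can_inj fK); rewrite gK raddfB /= !gK.
- split=> [|x y]; apply: (can_inj fK); first by rewrite gK rmorph1.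
  by rewrite gK rmorphM /= !gK.
- by move=> c x; apply: (can_inj fK); rewrite gK linearZ /= gK.
Qed.

Lemma alg_iso_trans (k : nzRingType) (A B C : algType k) :
  alg_iso A B -> alg_iso B C -> alg_iso A C.
Proof.
move=> [f bf] [g bg].
by exists (g \o f : {lrmorphism A -> C}); apply: bij_comp.
Qed.

Lemma matalg_iso (k : nzRingType) (A B : algType k) n :
  alg_iso A B -> alg_iso (matalg A n) (matalg B n).
Proof.
move=> [f [g fK gK]].
apply: (@alg_isoI k (matalg A n) (matalg B n) (map_mx f) (map_mx g)).
- by move=> M N; rewrite map_mxB.
- by split=> [|M N]; [rewrite map_mx1 | rewrite map_mxM].
- by move=> c M; apply/matrixP=> i j; rewrite !mxE linearZ.
- by move=> M; apply/matrixP=> i j; rewrite !mxE.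
- by move=> M; apply/matrixP=> i j; rewrite !mxE.
Qed.

Lemma skew_sumE (k : nzRingType) (gT : finGroupType) (A : algType k)
    (alpha : algaction gT A) (I : finType) (F : I -> skew_group alpha) g :
  (\sum_i F i) g = \sum_i F i g.
Proof.
apply: (big_morph (fun x : skew_group alpha => x g)) => [x y|];
  by rewrite ffunE.
Qed.

(** The entries of an identity matrix over the skew group ring have this boolean form. *)
Lemma skew_boolE (k : nzRingType) (gT : finGroupType) (A : algType k)
    (alpha : algaction gT A) (b : bool) g :
  (b%:R : skew_group alpha) g = (b && (g == 1%g))%:R.
Proof. by case: b; rewrite ffunE. Qed.

Lemma skew_mulE (k : nzRingType) (gT : finGroupType) (A : algType k)
    (alpha : algaction gT A) (x y : skew_group alpha) m :
  (x * y) m = \sum_g x g * alpha g (y (g^-1 * m)%g).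
Proof. by rewrite ffunE. Qed.

(** * Matrices over a skew group ring *)

Section MatrixSkewGroup.
Variables (k : nzRingType) (gT : finGroupType) (A : algType k) (n : nat).
Variable alpha : algaction gT A.

Definition mat_act (g : gT) : matalg A n -> matalg A n := map_mx (alpha g).

Fact mat_act_zmod g : zmod_morphism (mat_act g).
Proof. by move=> M N; rewrite /mat_act map_mxB. Qed.
Fact mat_act_monoid g : monoid_morphism (mat_act g).
Proof. by split=> [|M N]; rewrite /mat_act ?map_mx1 ?map_mxM. Qed.
Fact mat_act_scalable g : scalable (mat_act g).
Proof. by move=> c M; apply/matrixP=> i j; rewrite !mxE linearZ. Qed.
HB.instance Definition _ g := GRing.isZmodMorphism.Build
  (matalg A n) (matalg A n) (mat_act g) (mat_act_zmod g).
HB.instance Definition _ g := GRing.isMonoidMorphism.Build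
  (matalg A n) (matalg A n) (mat_act g) (mat_act_monoid g).
HB.instance Definition _ g := GRing.isScalable.Build
  k (matalg A n) (matalg A n) *:%R (mat_act g) (mat_act_scalable g).

Fact mat_act1 M : mat_act 1%g M = M.
Proof. by apply/matrixP=> i j; rewrite mxE act_id. Qed.
Fact mat_actM g h M : mat_act (g * h)%g M = mat_act g (mat_act h M).
Proof. by apply/matrixP=> i j; rewrite !mxE act_mul. Qed.

Definition mat_action : algaction gT (matalg A n) :=
  @AlgAction k gT (matalg A n)
    (fun g => mat_act g : {lrmorphism matalg A n -> matalg A n})
    mat_act1 mat_actM.

(** A matrix of formal sums is a formal sum of matrices: [f] and [h] only reorder the indices [i],
    [j], [g]. Products agree because [mat_action] acts entrywise. *)
Lemma matalg_skew_group :
  alg_iso (matalg (skew_group alpha) n) (skew_group mat_action).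
Proof.
pose f (M : matalg (skew_group alpha) n) : skew_group mat_action :=
  [ffun g => \matrix_(i, j) (M i j : {ffun gT -> A}) g].
pose h (x : skew_group mat_action) : matalg (skew_group alpha) n :=
  \matrix_(i, j) ([ffun g => (x g : 'M_n.+1) i j] : skew_group alpha).
apply: (@alg_isoI _ _ _ f h).
- move=> M N; apply/ffunP=> g; rewrite !ffunE.
  by apply/matrixP=> i j; rewrite !mxE !ffunE.
- split=> [|M N]; apply/ffunP=> g; rewrite !ffunE; apply/matrixP=> i j.
    rewrite mxE [in LHS]mxE skew_boolE andbC.
    by case: (g == 1%g); rewrite mxE.
  rewrite !mxE skew_sumE summxE.
  under eq_bigr do rewrite skew_mulE.
  rewrite exchange_big /=; apply: eq_bigr => m _.
  by rewrite mxE; apply: eq_bigr => l _; rewrite !ffunE !mxE.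
- move=> c M; apply/ffunP=> g; rewrite !ffunE.
  by apply/matrixP=> i j; rewrite !mxE !ffunE.
- by move=> M; apply/matrixP=> i j; apply/ffunP=> g; rewrite !mxE !ffunE !mxE.
- by move=> x; apply/ffunP=> g; apply/matrixP=> i j; rewrite !ffunE !mxE !ffunE.
Qed.

End MatrixSkewGroup.

(** * Bicharacters of finite abelian groups *)

(** Since [n] is invertible, [X^n - 1] is separable and has [n] distinct roots; among them is a
    primitive one. *)
Lemma closed_prim_root (k : closedFieldType) n :
  (n%:R : k) != 0 -> exists z : k, n.-primitive_root z.
Proof.
move=> n0; have n_gt0 : (0 < n)%N by case: n n0; rewrite ?eqxx.
have [r Dr] := closed_field_poly_normal ('X^n - 1 : {poly k}).
rewrite lead_coefXnsubC // scale1r in Dr.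
have : has n.-primitive_root r.
  apply: has_prim_root => //.
  - by apply/allP=> x xr; rewrite /root_of_unity Dr root_prod_XsubC.
  - by rewrite -separable_prod_XsubC -Dr separable_Xn_sub_1.
  - by rewrite -ltnS -(size_prod_XsubC _ id) -Dr size_XnsubC.
by case/hasP=> z _ zP; exists z.
Qed.

Section Bicharacter.
Variables (k : closedFieldType) (gT : finGroupType).
Implicit Types (G H : {group gT}) (chi : gT -> gT -> k).
Local Open Scope group_scope.

(** The condition at [1] excludes zero values, which multiplicativity alone would allow; the last
    condition is nondegeneracy. *)
Definition bicharacter G chi : Prop :=
  [/\ {in G & G, forall g h, chi g h = chi h g},
      {in G, forall g, chi 1 g = 1%R},
      {in G & G & G, forall g h x, chi (g * h) x = (chi g x * chi h x)%R}
    & {in G, forall g, {in G, forall h, chi g h = 1%R} -> g = 1}].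

(** For a primitive root [z] of order [#[x]], the pairing of [x ^+ i] with [x ^+ j] is
    [z ^+ (i * j)]. *)
Lemma cycle_bicharacter (x : gT) :
  (#[x]%:R != 0 :> k)%R -> exists chi, bicharacter <[x]> chi.
Proof.
move=> /closed_prim_root [z zP].
(* The discrete logarithm to base [x], with value 0 outside the cycle. *)
pose dlog (g : gT) : nat :=
  odflt 0 (omap (@nat_of_ord _) [pick i : 'I_#[x] | x ^+ i == g]).
have dlogK g : g \in <[x]> -> x ^+ dlog g = g.
  case/cyclePmin=> i ix ->; rewrite /dlog.
  case: pickP => [j /eqP //|/(_ (Ordinal ix))].
  by rewrite eqxx.
have dlog1 : dlog 1 = 0.
  have: dlog 1 == 0 %[mod #[x]].
    by rewrite -eq_expg_mod_order dlogK ?group1 // expg0.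
  by rewrite mod0n modn_small => [/eqP|] //; rewrite /dlog; case: pickP => /=.
exists (fun g h => z ^+ (dlog g * dlog h))%R.
split=> [g h _ _|g gx|g h y gx hx _|g gx g1].
- by rewrite mulnC.
- by rewrite dlog1 mul0n expr0.
- apply/eqP; rewrite -exprD -mulnDl (eq_prim_root_expr zP).
  rewrite -modnMml -[X in _ == X]modnMml.
  suff -> : dlog (g * h) = dlog g + dlog h %[mod #[x]] by [].
  by apply/eqP; rewrite -eq_expg_mod_order expgD !dlogK ?groupM.
(* Pairing with the generator is enough: the order divides [dlog g * dlog x], and [dlog x],
   congruent to 1, is coprime to it. *)
- rewrite -(dlogK g gx); apply/eqP; rewrite -order_dvdn.
  move: (g1 x (cycle_id x)) => /eqP; rewrite -(prim_order_dvd zP).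
  case: (leqP #[x] 1) => [|x1 d].
    rewrite leq_eqVlt ltnS leqNgt order_gt0 orbF => /eqP ->; by rewrite dvd1n.
  rewrite -(@Gauss_dvdl _ _ (dlog x)) // coprime_sym.
  suff -> : coprime (dlog x) #[x] by [].
  rewrite -coprime_modl.
  have /eqP : x ^+ dlog x = x ^+ 1 by rewrite dlogK ?cycle_id.
  by rewrite eq_expg_mod_order => /eqP ->; rewrite coprime_modl coprime1n.
Qed.

(** The pairings of the components are multiplied. Nondegeneracy is tested separately against [K]
    and [H], each of which sees only its own component. *)
Lemma dprod_bicharacter (K H G : {group gT}) chiK chiH :
  K \x H = G -> bicharacter K chiK -> bicharacter H chiH ->
  exists chi, bicharacter G chi.
Proof.
move=> defG [symK K1 mulK ndK] [symH H1 mulH ndH].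
have [_ KH cHK tiKH] := dprodP defG.
have nKG : K <| G by case: (dprod_normal2 defG).
have cKH : H \in [complements to K in G] by apply/complP.
(* The projections of the internal direct product. *)
pose a := divgr K H; pose b := remgr K H.
have aK g : g \in G -> a g \in K by move=> gG; apply: mem_divgr; rewrite KH.
have bH g : g \in G -> b g \in H by move=> gG; apply: mem_remgr; rewrite KH.
have aM : {in G &, {morph a : x y / x * y}} by apply: divgrM.
have bM : {in G &, {morph b : x y / x * y}} by apply: remgrM.
have abE g : g = a g * b g by exact: divgr_eq.
have abK h : h \in K -> a h = h /\ b h = 1.
  by move=> hK; rewrite /a /b divgr_id // remgr1.
have abH h : h \in H -> a h = 1 /\ b h = h.
  move=> hH; rewrite /b remgr_id //; split=> //.
  by rewrite /a -[X in divgr _ _ X](mul1g h) divgrMid.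
have [a1 b1] := abK 1 (group1 K).
clearbody a b.
exists (fun g h => chiK (a g) (a h) * chiH (b g) (b h))%R.
split=> [g h gG hG|g gG|g h x gG hG xG|g gG g1].
- by rewrite (symK _ _ (aK g gG) (aK h hG)) (symH _ _ (bH g gG) (bH h hG)).
- by rewrite a1 b1 (K1 _ (aK g gG)) (H1 _ (bH g gG)) mulr1.
- rewrite aM // bM // (mulK _ _ _ (aK g gG) (aK h hG) (aK x xG)).
  by rewrite (mulH _ _ _ (bH g gG) (bH h hG) (bH x xG)) mulrACA.
- have ag1 : a g = 1.
    apply: (ndK _ (aK g gG)) => h hK.
    have hG : h \in G by rewrite -KH -[h]mulg1 mem_mulg.
    have [ah bh] := abK h hK; have := g1 h hG.
    by rewrite ah bh (symH _ _ (bH g gG) (group1 H)) (H1 _ (bH g gG)) mulr1.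
  have bg1 : b g = 1.
    apply: (ndH _ (bH g gG)) => h hH.
    have hG : h \in G by rewrite -KH -[h]mul1g mem_mulg.
    have [ah bh] := abH h hH; have := g1 h hG.
    by rewrite ah bh (symK _ _ (aK g gG) (group1 K)) (K1 _ (aK g gG)) mul1r.
  by rewrite (abE g) ag1 bg1 mulg1.
Qed.

(** Induction along a decomposition into cyclic factors; the order of each factor stays invertible
    in [k]. *)
Lemma abelian_bicharacter G :
  abelian G -> (#|G|%:R != 0 :> k)%R -> exists chi, bicharacter G chi.
Proof.
move=> /abelian_structure [b defG _].
elim: b G defG => [|x b IH] G; rewrite ?big_nil ?big_cons => defG nG.
  exists (fun _ _ => 1%R); split=> // [g h x|g]; rewrite ?mulr1 //.
  by rewrite -defG => /set1gP.
have [[_ H _ defH] _ _ _] := dprodP defG; rewrite defH in defG.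
move: nG; rewrite -(dprod_card defG) natrM mulf_eq0 negb_or => /andP[nx nH].
have [chiK chiKP] := cycle_bicharacter nx.
have [chiH chiHP] := IH H defH nH.
exact: dprod_bicharacter defG chiKP chiHP.
Qed.

(** Translating the index by [x] multiplies the sum by [chi x h]. A nonzero sum would make all these
    values 1, so [h] would be trivial by nondegeneracy. *)
Lemma bicharacter_sum G chi h : bicharacter G chi -> h \in G -> h != 1 ->
  (\sum_(g in G) chi g h = 0)%R.
Proof.
move=> [sym chi1 mul nd] hG; apply: contraNeq => s0.
apply/eqP; apply: nd => // x xG; rewrite sym //.
apply: (mulIf s0); rewrite mul1r mulr_sumr [RHS](reindex_inj (mulgI x)) /=.
apply: eq_big => [g|g gG]; first by rewrite groupMl.
by rewrite mul.
Qed.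
End Bicharacter.

(** * Algebras graded by a regular orbit of idempotents *)

Section Eigenunits.
Variables (k : fieldType) (gT : finGroupType) (A : algType k).
Variables (alpha : algaction gT A) (chi : gT -> gT -> k) (u : gT -> A).
Local Notation B := (fixalg alpha).
Hypothesis cardG : (#|gT|%:R : k) != 0.
Hypothesis chi1 : forall g, chi 1%g g = 1.
Hypothesis chiM : forall g h x, chi (g * h)%g x = chi g x * chi h x.
Hypothesis chi_sum : forall h, h != 1%g -> \sum_g chi g h = 0.
Hypothesis chiC : forall g h, chi g h = chi h g.
Hypothesis u1 : u 1%g = 1.
Hypothesis uM : forall g h, u (g * h)%g = u g * u h.
Hypothesis act_u : forall g h, alpha h (u g) = chi g h *: u g.

Let uV g : u g * u g^-1%g = 1. Proof. by rewrite -uM mulgV u1. Qed.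
Let Vu g : u g^-1%g * u g = 1. Proof. by rewrite -uM mulVg u1. Qed.
Let chiV g h : chi g h * chi g^-1%g h = 1.
Proof. by rewrite -chiM mulgV chi1. Qed.

Lemma fixvalE (x : B) g : alpha g (fixval x) = fixval x.
Proof. by have := valP x; rewrite inE => /forallP/(_ g)/eqP. Qed.

Lemma fixvalB (x y : B) : fixval (x - y) = fixval x - fixval y.
Proof. by []. Qed.

Lemma fixvalZ c (x : B) : fixval (c *: x) = c *: fixval x.
Proof. by []. Qed.

Lemma fixvalM (x y : B) : fixval (x * y) = fixval x * fixval y.
Proof. by []. Qed.

Lemma fixval1 : fixval (1 : B) = 1.
Proof. by []. Qed.

Lemma fixval_sum (I : finType) (F : I -> B) :
  fixval (\sum_i F i) = \sum_i fixval (F i).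
Proof. by apply: (big_morph (fun x : B => fixval x)). Qed.

(** The characters of [u g] and of its inverse cancel. *)
Fact conj_fixed g (x : B) : u g * fixval x * u g^-1%g \in fixed_pred alpha.
Proof.
rewrite inE; apply/forallP=> h; rewrite !rmorphM /= !act_u fixvalE.
by rewrite -!scalerAl -scalerAr scalerA chiV scale1r.
Qed.
Definition conj_fix g (x : B) : B := FixAlg (conj_fixed g x).
Fact conj_fix_zmod g : zmod_morphism (conj_fix g).
Proof. by move=> x y; apply: val_inj; rewrite /= mulrBr mulrBl. Qed.
Fact conj_fix_monoid g : monoid_morphism (conj_fix g).
Proof.
split=> [|x y]; apply: val_inj; rewrite /= ?mulr1 ?uV //.
by rewrite !mulrA -(mulrA _ (u g^-1%g)) Vu mulr1.
Qed.
Fact conj_fix_scalable g : scalable (conj_fix g).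
Proof. by move=> c x; apply: val_inj; rewrite /= -scalerAr -scalerAl. Qed.
HB.instance Definition _ g :=
  GRing.isZmodMorphism.Build B B (conj_fix g) (conj_fix_zmod g).
HB.instance Definition _ g :=
  GRing.isMonoidMorphism.Build B B (conj_fix g) (conj_fix_monoid g).
HB.instance Definition _ g :=
  GRing.isScalable.Build k B B *:%R (conj_fix g) (conj_fix_scalable g).
Fact conj_fix1 x : conj_fix 1%g x = x.
Proof. by apply: val_inj; rewrite /= invg1 u1 mul1r mulr1. Qed.
Fact conj_fixM g h x : conj_fix (g * h)%g x = conj_fix g (conj_fix h x).
Proof. by apply: val_inj; rewrite /= invMg !uM !mulrA. Qed.
Definition fix_action : algaction gT B :=
  @AlgAction k gT B (fun g => conj_fix g : {lrmorphism B -> B})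
    conj_fix1 conj_fixM.

(** The averaging projector onto the part of [A] on which the group acts through the character
    [chi g]. *)
Definition isotypic g (s : A) : A :=
  #|gT|%:R^-1 *: \sum_h chi g^-1%g h *: alpha h s.

Lemma act_isotypic g h s : alpha h (isotypic g s) = chi g h *: isotypic g s.
Proof.
rewrite /isotypic linearZ /= scalerA mulrC -scalerA; congr (_ *: _).
rewrite raddf_sum scaler_sumr [RHS](reindex_inj (mulgI h)) /=.
apply: eq_bigr => x _; rewrite linearZ /= -act_mul scalerA; congr (_ *: _).
by rewrite (chiC g^-1%g (h * x)%g) chiM !(chiC _ g^-1%g) mulrA chiV mul1r.
Qed.

(** After exchanging the sums, orthogonality of characters leaves only the term [h = 1]. *)
Lemma isotypic_sum s : \sum_g isotypic g s = s.
Proof.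
rewrite -scaler_sumr exchange_big /=.
under eq_bigr do rewrite -scaler_suml (reindex_inj invg_inj) /=.
rewrite (bigD1 1%g) //= [X in _ + X]big1 ?addr0 => [|h h1].
  rewrite act_id scalerA (eq_bigr (fun=> 1)) => [|g _].
    by rewrite sumr_const mulVf ?scale1r.
  by rewrite invgK chiC chi1.
by rewrite (eq_bigr (chi^~ h)) ?chi_sum ?scale0r // => g _; rewrite invgK.
Qed.

Lemma isotypic_eigen g m (s : A) :
  (forall h, alpha h s = chi m h *: s) -> isotypic g s = (g == m)%:R *: s.
Proof.
move=> act_s; rewrite /isotypic.
under eq_bigr do rewrite act_s scalerA -chiM chiC.
rewrite -scaler_suml; have [->|gm] := eqVneq g m.
  under eq_bigr do rewrite mulVg chiC chi1.
  by rewrite sumr_const scalerA mulVf.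
by rewrite chi_sum ?scale0r ?scaler0 // -eq_mulVg1.
Qed.

Fact isotypic_fixed g s : isotypic g s * u g^-1%g \in fixed_pred alpha.
Proof.
rewrite inE; apply/forallP=> h; rewrite rmorphM /= act_u act_isotypic.
by rewrite -scalerAl -scalerAr scalerA chiV scale1r.
Qed.

(** Right multiplication by the unit [u g] carries the fixed algebra onto the isotypic part of [g],
    so each element is uniquely a sum of terms [x_g * u g]. Moving [u g] past a fixed element is
    conjugation, that is, [fix_action]. *)
Theorem eigenunits_skew_group : alg_iso A (skew_group fix_action).
Proof.
apply: alg_iso_sym.
pose f (x : skew_group fix_action) : A := \sum_g fixval (x g) * u g.
pose h (s : A) : skew_group fix_action :=
  [ffun g => FixAlg (isotypic_fixed g s)].
apply: (@alg_isoI _ _ _ f h).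
- by move=> x y; rewrite -sumrB; apply: eq_bigr => g _; rewrite !ffunE mulrBl.
- split=> [|x y].
    rewrite /f (bigD1 1%g) //= big1 => [|g g1].
      by rewrite ffunE eqxx u1 mulr1 addr0.
    by rewrite ffunE (negbTE g1) mul0r.
  rewrite /f; under eq_bigr do rewrite skew_mulE fixval_sum mulr_suml.
  rewrite exchange_big mulr_suml /=; apply: eq_bigr => g _.
  rewrite (reindex_inj (mulgI g)) mulr_sumr /=; apply: eq_bigr => m _.
  by rewrite mulKg uM !mulrA -(mulrA _ (u g^-1%g)) Vu mulr1.
- move=> c x; rewrite scaler_sumr; apply: eq_bigr => g _.
  by rewrite !ffunE scalerAl.
- move=> x; apply/ffunP=> g; rewrite ffunE; apply: val_inj => /=.
  have isoB : isotypic g (f x) = \sum_m isotypic g (fixval (x m) * u m).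
    rewrite -scaler_sumr exchange_big /=; congr (_ *: _); apply: eq_bigr => m _.
    by rewrite raddf_sum scaler_sumr.
  rewrite isoB (bigD1 g) //= big1 => [|m mg].
    rewrite (@isotypic_eigen g g) => [|m].
      by rewrite eqxx scale1r addr0 -mulrA uV mulr1.
    by rewrite rmorphM /= act_u fixvalE scalerAr.
  rewrite (@isotypic_eigen g m) 1?eq_sym ?(negbTE mg) ?scale0r // => l.
  by rewrite rmorphM /= act_u fixvalE scalerAr.
- move=> s; rewrite /f -[RHS]isotypic_sum; apply: eq_bigr => g _.
  by rewrite ffunE /= -mulrA Vu mulr1.
Qed.
End Eigenunits.

Section RegularIdempotents.
Variables (k : closedFieldType) (gT : finGroupType) (A : algType k).
Variables (alpha : algaction gT A) (e : gT -> A).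

Theorem regular_idempotents_skew_group :
    abelian [set: gT] -> (#|gT|%:R : k) != 0 ->
    (forall g h, e g * e h = (g == h)%:R *: e g) -> \sum_g e g = 1 ->
    (forall g h, alpha h (e g) = e (h * g)%g) ->
  exists beta : algaction gT (fixalg alpha), alg_iso A (skew_group beta).
Proof.
move=> abG cardG eM e1 act_e.
have [|chi chiP] := @abelian_bicharacter k gT [set: gT]%G abG.
  by rewrite cardsT.
have chi_sum h : h != 1%g -> \sum_g chi g h = 0.
  move=> h1; rewrite -[RHS](bicharacter_sum chiP (in_setT h) h1).
  by apply: eq_bigl => g; rewrite inE.
case: chiP => chiC chi1 chiM _.
have {}chiC g h : chi g h = chi h g by apply: chiC; rewrite inE.
have {}chi1 g : chi 1%g g = 1 by apply: chi1; rewrite inE.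
have {}chiM g h x : chi (g * h)%g x = chi g x * chi h x.
  by apply: chiM; rewrite inE.
(* A Fourier transform of the idempotents. The inverse makes translation of the [e h] produce the
   factor [chi g] rather than its inverse. *)
pose u g := \sum_h chi g^-1%g h *: e h.
have u1 : u 1%g = 1.
  by rewrite -e1; apply: eq_bigr => h _; rewrite invg1 chi1 scale1r.
have uM g h : u (g * h)%g = u g * u h.
  rewrite mulr_suml; apply: eq_bigr => x _; rewrite mulr_sumr (bigD1 x) //=.
  rewrite big1 ?addr0 => [|y yx].
    by rewrite -scalerAl -scalerAr eM eqxx scale1r scalerA invMg chiM mulrC.
  by rewrite -scalerAl -scalerAr eM eq_sym (negbTE yx) scale0r !scaler0.
have act_u g h : alpha h (u g) = chi g h *: u g.
  rewrite raddf_sum scaler_sumr [RHS](reindex_inj (mulgI h)) /=.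
  apply: eq_bigr => x _; rewrite linearZ /= act_e scalerA; congr (_ *: _).
  rewrite (chiC g^-1%g (h * x)%g) chiM !(chiC _ g^-1%g) mulrA.
  by rewrite -chiM mulgV chi1 mul1r.
exists (fix_action chi1 chiM u1 uM act_u).
exact: eigenunits_skew_group.
Qed.
End RegularIdempotents.

(** * Modules *)

(** Bundles maps shown linear inside a proof, in particular one function viewed between differently
    twisted modules. *)
Lemma linearI (R : nzRingType) (M N : lmodType R) (f : M -> N) :
  linear f -> exists F : {linear M -> N}, F =1 f.
Proof.
move=> fL; pose aL := GRing.isLinear.Build R M N *:%R f fL.
pose F : {linear M -> N} := HB.pack f aL.
by exists F.
Qed.

Section ModuleTheory.
Variable R : nzRingType.
Implicit Types M N W : lmodType R.

Lemma submod_closed_ker M N (f : {linear M -> N}) :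
  submod_closed [pred x | f x == 0].
Proof.
split=> [|a x y]; rewrite !inE ?linear0 // => /eqP fx /eqP fy.
by rewrite linearP fx fy scaler0 addr0.
Qed.

Lemma submod_closed_im M N (f : {linear M -> N}) (L : {pred M}) :
  submod_closed L ->
  submod_closed [pred y | `[< exists2 x, x \in L & f x = y >]].
Proof.
move=> [L0 LP]; split=> [|a u v]; rewrite !inE.
  by apply/asboolP; exists 0; rewrite ?linear0.
move=> /asboolP[x xL <-] /asboolP[y yL <-]; apply/asboolP.
by exists (a *: x + y); [exact: LP | rewrite linearP].
Qed.

Lemma simple_hom_bij M N (f : {linear M -> N}) :
  simple_mod M -> simple_mod N -> (exists x, f x != 0) -> bijective f.
Proof.
move=> [_ sM] [_ sN] [x fx].
have ker0 : [pred x | f x == 0] =i pred1 0.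
  have [//|kT] := sM _ (submod_closed_ker f).
  by have := kT x; rewrite !inE (negbTE fx).
have f_inj : injective f.
  move=> a b /eqP; rewrite -subr_eq0 -linearB => fab.
  by have := ker0 (a - b); rewrite !inE fab => /esym; rewrite subr_eq0 => /eqP.
have f_surj y : exists x, f x = y.
  have T0 : submod_closed (@predT M) by [].
  case: (sN _ (submod_closed_im f T0)) => [/(_ (f x))|/(_ y)].
    rewrite !inE (negbTE fx) => /asboolP[]; by exists x.
  by rewrite !inE => /asboolP[z _ <-]; exists z.
have [g gK] := choice f_surj.
by exists g => // z; apply: f_inj; rewrite gK.
Qed.

(** [h] is [f] after a set-theoretic section of [p]; it is linear because [f] is constant on the
    fibres of [p]. *)
Lemma hom_factor M N W (p : {linear M -> N}) (f : {linear M -> W}) :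
    surjective p -> (forall x, p x = 0 -> f x = 0) ->
  exists h : {linear N -> W}, forall x, f x = h (p x).
Proof.
move=> /choice[s sK] kf.
have fp x y : p x = p y -> f x = f y.
  by move=> pxy; apply/subr0_eq; rewrite -linearB kf // linearB pxy subrr.
have [|h hE] := @linearI R N W (f \o s).
  move=> a x y /=; rewrite -linearP; apply: fp.
  by rewrite linearP !sK.
by exists h => x; rewrite hE; apply: fp; rewrite sK.
Qed.

(** If [f] maps [N] onto [W], then [N] and the kernel of [f] together span [M], so superfluity makes
    the kernel all of [M]. *)
Lemma superfluous_ker_hom M W (N : {pred M}) (f : {linear M -> W}) :
  superfluous N -> submod_closed N -> simple_mod W ->
  forall x, x \in N -> f x = 0.
Proof.
move=> sN cN [_ sW] x xN.
have [im0|imT] := sW _ (submod_closed_im f cN).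
  have := im0 (f x); rewrite !inE => fx; apply/eqP; rewrite -fx.
  by apply/asboolP; exists x.
suff /(_ x) : [pred x | f x == 0] =i predT by rewrite !inE => /eqP.
apply: sN (submod_closed_ker f) _ => m.
have := imT (f m); rewrite !inE => /asboolP[y yN fy].
by exists y, (m - y); rewrite yN inE linearB fy subrr eqxx [y + _]addrC subrK.
Qed.

Section Biproduct.
Variables (M : lmodType R) (I : finType) (Mi : I -> lmodType R).
Variables (inc : forall i, {linear Mi i -> M}).
Variables (prj : forall i, {linear M -> Mi i}).
Hypothesis biprod : forall m, \sum_i inc i (prj i m) = m.

Lemma projective_biproduct : (forall i, projective (Mi i)) -> projective M.
Proof.
move=> pM X Y f h sf.
pose l i := projT1 (cid (pM i X Y f (h \o inc i : {linear Mi i -> Y}) sf)).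
have lE i x : f (l i x) = h (inc i x) by rewrite /l; case: cid => l0 /= /(_ x).
have [|L LE] := @linearI R M X (fun m => \sum_i l i (prj i m)).
  move=> a x y; rewrite scaler_sumr -big_split /=; apply: eq_bigr => i _.
  by rewrite !linearP.
exists L => m /=; rewrite LE -[in RHS](biprod m) !raddf_sum.
by apply: eq_bigr => i _ /=; rewrite lE.
Qed.

Lemma superfluous_biproduct (N : forall i, {pred Mi i}) :
  (forall i, submod_closed (N i)) -> (forall i, superfluous (N i)) ->
  superfluous [pred m | [forall i, prj i m \in N i]].
Proof.
move=> cN sN L cL NL.
(* [Ls s] is [L] plus the parts of [\sum_i inc i (N i)] indexed by [s]; the
   summands are removed one at a time. *)
pose Ls (s : seq I) : {pred M} := [pred m | `[< exists n : forall i, Mi i,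
  (forall i, n i \in N i) /\ m - \sum_(i <- s) inc i (n i) \in L >]].
have cLs s : submod_closed (Ls s).
  case: cL => L0 LP; split=> [|a x y]; rewrite !inE.
    apply/asboolP; exists (fun=> 0); split=> [i|]; first by case: (cN i).
    by rewrite big1 ?subr0 // => i _; rewrite linear0.
  move=> /asboolP[n [nN xL]] /asboolP[m [mN yL]]; apply/asboolP.
  exists (fun i => a *: n i + m i); split=> [i|].
    by case: (cN i) => _; apply.
  suff -> : \sum_(i <- s) inc i (a *: n i + m i) =
    a *: (\sum_(i <- s) inc i (n i)) + \sum_(i <- s) inc i (m i).
    by rewrite opprD addrACA -scalerBr; apply: LP.
  rewrite scaler_sumr -big_split; apply: eq_bigr => i _ /=.
  by rewrite linearP.
have LsT s : Ls s =i predT -> L =i predT.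
  elim: s => [|i s IH] LT.
    move=> m; have := LT m; rewrite !inE => /asboolP[n [_]].
    by rewrite big_nil subr0.
  apply: IH.
  (* The preimage of [Ls s] in the summand [Mi i] becomes everything once [N i] is added, so it is
     already everything. *)
  have iT : [pred x | inc i x \in Ls s] =i predT.
    apply: sN.
      split=> [|a x y]; rewrite !inE ?linear0; first by case: (cLs s).
      by rewrite linearP; case: (cLs s) => _; apply.
    move=> x; have := LT (inc i x); rewrite !inE => /asboolP[n [nN]].
    rewrite big_cons => xL; exists (n i), (x - n i).
    rewrite [n i + _]addrC subrK; split=> //; rewrite !inE.
    apply/asboolP; exists n.
    by rewrite linearB -addrA -opprD.
  move=> m; have := LT m; rewrite !inE => /asboolP[n [nN]].
  rewrite big_cons opprD addrA => mL.
  have : inc i (n i) + (m - inc i (n i)) \in Ls s.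
    case: (cLs s) => _ LP; rewrite -[X in X + _]scale1r; apply: LP.
      by have := iT (n i); rewrite !inE.
    by rewrite !inE; apply/asboolP; exists n.
  by rewrite addrC subrK.
(* An element whose projections lie in the [N i] is the sum of these projections, so the full index
   list gives all of [M]. *)
apply: (LsT (index_enum I)) => m; rewrite !inE; apply/asboolP.
have [x [y [xN yL ->]]] := NL m; move: xN; rewrite inE => /forallP xN.
by exists (fun i => prj i x); split=> //; rewrite biprod addrC addKr.
Qed.
End Biproduct.

End ModuleTheory.

(** * Schur's lemma and density for the twists of a simple module *)

Lemma has_dim_basis (k : fieldType) n (W : lmodType k) : has_dim n W ->
  exists v : 'I_n -> W,
    (forall x, exists c : 'I_n -> k, x = \sum_i c i *: v i) /\
    (forall c : 'I_n -> k, \sum_i c i *: v i = 0 -> forall i, c i = 0).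
Proof.
case=> -[f fL [g fK gK]].
pose F : {linear W -> 'rV[k]_n} :=
  HB.pack f (GRing.isLinear.Build k W _ *:%R f fL).
have fE c : f (\sum_i c i *: g (delta_mx 0 i)) = \row_i c i.
  rewrite -[f]/(F : W -> _) linear_sum [RHS]row_sum_delta.
  by apply: eq_bigr => i _; rewrite linearZ /= gK mxE.
exists (fun i => g (delta_mx 0 i)); split=> [x|c s0 i].
  exists (fun i => f x 0 i); apply: (can_inj fK); rewrite fE.
  by apply/rowP=> i; rewrite mxE.
by have /rowP/(_ i) := fE c; rewrite s0 -[f]/(F : W -> _) linear0 !mxE.
Qed.

(** In coordinates [f] is a matrix of size [n.+1]; its characteristic polynomial is nonconstant and
    so has a root. *)
Lemma eigenvector_exists (k : closedFieldType) n (W : lmodType k)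
    (f : {linear W -> W}) :
  has_dim n.+1 W -> exists (c : k) (x : W), x != 0 /\ f x = c *: x.
Proof.
case=> -[a aL [b aK bK]].
pose F : {linear W -> 'rV[k]_n.+1} :=
  HB.pack a (GRing.isLinear.Build k W _ *:%R a aL).
have [|B BE] := @linearI k _ W b.
  move=> c x y; apply: (can_inj aK).
  by rewrite -[a]/(F : W -> _) linearP /= !bK.
pose A := lin1_mx (F \o f \o B).
have [c cP] : exists c, root (char_poly A) c.
  by apply/closed_rootP; rewrite size_char_poly.
rewrite -eigenvalue_root_char in cP.
have [x xA x0] := eigenvalueP cP.
exists c, (B x); split.
  apply: contraNneq x0 => Bx; rewrite -[x]bK -BE Bx.
  by rewrite -[a]/(F : W -> _) linear0.
apply: (can_inj aK).
by rewrite -[a]/(F : W -> _) linearZ /= [in RHS]BE [in RHS]bK -xA mul_rV_lin1.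
Qed.

Section Schur.
Variables (k : closedFieldType) (R : algType k).

Lemma scalar_central (c : k) (r : R) : c%:A * r = r * c%:A.
Proof. by rewrite -scalerAl -scalerAr mul1r mulr1. Qed.

(** An eigenspace of [f] is a submodule because scalars are central in [R]; being nonzero, it is all
    of [V]. *)
Lemma schur (V : lmodType R) n (f : {linear V -> V}) :
  simple_mod V -> has_dim n.+1 (restr V) ->
  exists c : k, forall x, f x = (c%:A : R) *: x.
Proof.
move=> [_ sV] dV.
have [|g gE] := @linearI k (restr V) (restr V) f.
  by move=> a x y; rewrite -linearP.
have [c [x [x0 gx]]] := eigenvector_exists g dV.
exists c; have [||fT] := sV [pred x | f x == (c%:A : R) *: x].
- split=> [|a y z]; rewrite !inE; first by rewrite linear0 scaler0.
  move=> /eqP fy /eqP fz; rewrite linearP fy fz scalerDr.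
  by rewrite !scalerA scalar_central.
- move=> /(_ x); rewrite !inE (negbTE x0) => /negP[]; apply/eqP; rewrite -gE.
  exact: gx.
- by move=> y; have := fT y; rewrite !inE => /eqP.
Qed.
End Schur.

Section TwistedSimples.
Variables (k : closedFieldType) (gT : finGroupType) (R : algType k).
Variables (tau : algaction gT R) (V : lmodType R) (t : nat).
Hypothesis V_twists : complete_simples (fun g : gT => twist tau g V).
Hypothesis V_dim : has_dim t.+1 (restr V).

Lemma twist_scaleE g (r : R) (x : twist tau g V) :
  r *: x = tau g^-1%g r *: (x : V).
Proof. by []. Qed.

Lemma act_scalar g (c : k) : tau g (c%:A) = c%:A :> R.
Proof. by rewrite linearZ rmorph1. Qed.

(** Automorphisms fix the scalars, so a twist has the same dimension as [V], and the scalar may be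
    read in [V] itself. *)
Lemma twist_hom_scalar g (f : {linear twist tau g V -> twist tau g V}) :
  exists c : k, forall x, f x = (c%:A : R) *: (x : V).
Proof.
have dgV : has_dim t.+1 (restr (twist tau g V)).
  case: V_dim => -[a aL ab]; constructor; exists a => // c x y.
  rewrite -aL; congr (a (_ + _)).
  by rewrite -[LHS]/(tau g^-1%g c%:A *: (x : V)) act_scalar.
have [sV _ _] := V_twists.
have [c cE] := schur f (sV g) dgV.
by exists c => x; rewrite cE twist_scaleE act_scalar.
Qed.

Lemma twist_hom_neq0 g h (f : {linear twist tau g V -> twist tau h V}) :
  g != h -> forall x, f x = 0.
Proof.
move=> gh x; apply/eqP; apply: contraNT gh => fx.
have [sV iV _] := V_twists; apply/eqP/iV; exists f.
by apply: simple_hom_bij; [exact: sV | exact: sV | exists x].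
Qed.

(** Jacobson density for all twists at once, by induction on the prescribed pairs [(g, i)]. Pairs
    with distinct [g] are independent because the twists are non-isomorphic; pairs with the same
    [g], by Schur's lemma and the freeness of [v]. *)
Lemma twist_density n (v : 'I_n -> V) :
    (forall c : 'I_n -> k, \sum_i (c i)%:A *: v i = 0 -> forall i, c i = 0) ->
  forall y : gT -> 'I_n -> V, exists r, forall g i, tau g^-1%g r *: v i = y g i.
Proof.
move=> v_free y.
suff main (s : seq (gT * 'I_n)) : uniq s -> forall y : gT * 'I_n -> V,
    exists r, forall j, j \in s -> tau j.1^-1%g r *: v j.2 = y j.
  have [r rP] := main (enum {: gT * 'I_n}) (enum_uniq _) (fun j => y j.1 j.2).
  by exists r => g i; apply: (rP (g, i)); rewrite mem_enum.
(* If the annihilator [ann] of the vectors indexed by [s] does not kill the next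
   vector [v i0], it moves it anywhere in the simple module.  Otherwise
   [r v_j |-> r (v i0)] is well defined for [r] killing the other vectors of
   [s], and Schur's lemma makes [v i0] a combination of the [v j]. *)
elim: s => [|[g0 i0] s IH] /=; first by exists 0.
move=> /andP[js us] {}y; have {}IH := IH us.
pose ann r := forall j, j \in s -> tau j.1^-1%g r *: v j.2 = 0.
have annP a r r' : ann r -> ann r' -> ann (a * r + r').
  move=> ar ar' j js'; rewrite rmorphD rmorphM /= scalerDl -scalerA.
  by rewrite ar // ar' // scaler0 addr0.
have [[r0 ar0 r0v]|noann] :=
  pselect (exists2 r, ann r & tau g0^-1%g r *: v i0 != 0).
  pose N : {pred twist tau g0 V} :=
    [pred x | `[< exists2 r, ann r & tau g0^-1%g r *: v i0 = x >]].
  have cN : submod_closed N.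
    split=> [|a x x']; rewrite !inE.
      apply/asboolP; exists 0; last by rewrite rmorph0 scale0r.
      by move=> j _; rewrite rmorph0 scale0r.
    move=> /asboolP[r ar <-] /asboolP[r' ar' <-]; apply/asboolP.
    exists (a * r + r'); first exact: annP.
    by rewrite rmorphD rmorphM /= scalerDl -scalerA.
  have [sV _ _] := V_twists; have [_ sg0] := sV g0.
  have [N0|NT] := sg0 N cN.
    have := N0 (tau g0^-1%g r0 *: v i0); rewrite !inE (negbTE r0v).
    by move=> /asboolP[]; exists r0.
  have [r1 r1P] := IH y.
  have := NT (y (g0, i0) - tau g0^-1%g r1 *: v i0).
  rewrite !inE => /asboolP[r ar rE]; exists (r + r1) => j.
  rewrite inE rmorphD scalerDl => /orP[/eqP ->|js'].
    by rewrite rE /= subrK.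
  by rewrite ar // r1P // add0r.
exfalso.
have {}noann r : ann r -> tau g0^-1%g r *: v i0 = 0.
  by move=> ar; apply: contra_notP noann => /eqP; exists r.
(* The action on [v i0] depends only on the action on the vectors indexed by [s]. *)
have eqann r r' : (forall j, j \in s ->
      tau j.1^-1%g r *: v j.2 = tau j.1^-1%g r' *: v j.2) ->
    tau g0^-1%g r *: v i0 = tau g0^-1%g r' *: v i0.
  move=> rr'; apply: subr0_eq; rewrite -scalerBl -rmorphB.
  apply: noann => j js'.
  by rewrite rmorphB scalerBl rr' // subrr.
(* Interpolating elements: [e j x] sends the vector of index [j] to [x] and kills the others in
   [s]. *)
have [e eP] : exists e : gT * 'I_n -> V -> R, forall j x, j \in s ->
    forall l, l \in s ->
    tau l.1^-1%g (e j x) *: v l.2 = if l == j then x else 0.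
  have /choice[e eP] : forall jx : (gT * 'I_n) * V, exists r,
      forall l, l \in s ->
      tau l.1^-1%g r *: v l.2 = if l == jx.1 then jx.2 else 0.
    by move=> jx; apply: IH.
  by exists (fun j x => e (j, x)) => j x _ l ls; rewrite eP.
have thetaP j : j \in s -> exists c : k, forall x,
    tau g0^-1%g (e j x) *: v i0 = if j.1 == g0 then (c%:A : R) *: x else 0.
  move=> js'.
  have [|f fE] := @linearI R (twist tau j.1 V) (twist tau g0 V)
      (fun x => tau g0^-1%g (e j x) *: v i0).
    move=> a x x'; rewrite [X in _ = X + _]twist_scaleE scalerA -rmorphM.
    rewrite -scalerDl [RHS]twist_scaleE.
    apply: eqann => l ls; rewrite rmorphD rmorphM /= scalerDl -scalerA !eP //.
    by case: eqP => [->|_]; rewrite ?scaler0 ?addr0.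
  have [jg0|jg0] := eqVneq.
    move: f fE; rewrite jg0 => f fE.
    have [c cE] := twist_hom_scalar f; exists c => x.
    by rewrite -cE fE.
  by exists 0 => x; rewrite -(twist_hom_neq0 f jg0 x) fE.
have {thetaP}[c cP] : exists c : gT * 'I_n -> k, forall j, j \in s -> forall x,
    tau g0^-1%g (e j x) *: v i0 = if j.1 == g0 then ((c j)%:A : R) *: x else 0.
  have /choice[c cP] : forall j : gT * 'I_n, exists c : k, j \in s -> forall x,
      tau g0^-1%g (e j x) *: v i0 = if j.1 == g0 then (c%:A : R) *: x else 0.
    move=> j; case: (boolP (j \in s)) => [/thetaP[c cE]|_]; last by exists 0.
    by exists c.
  by exists c.
have vi0 : v i0 =
    \sum_(j <- s) if j.1 == g0 then ((c j)%:A : R) *: v j.2 else 0.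
  (* The sum of the [e j (v j.2)] acts on the vectors indexed by [s] as [1] does, hence also on
     [v i0]. *)
  have : tau g0^-1%g 1 *: v i0 =
      tau g0^-1%g (\sum_(j <- s) e j (v j.2)) *: v i0.
    apply: eqann => l ls; rewrite rmorph1 scale1r raddf_sum scaler_suml.
    rewrite (bigD1_seq l) //= eP // eqxx.
    rewrite big_seq_cond big1 ?addr0 // => j /andP[js' jl].
    by rewrite eP // eq_sym (negbTE jl).
  rewrite rmorph1 scale1r raddf_sum scaler_suml => {1}->.
  by rewrite !big_seq; apply: eq_bigr => j js'; rewrite cP.
(* Collecting coefficients gives [v i0 = \sum_i d i v_i]. Since [(g0, i0)] is not in [s], [d i0] is
   0, which contradicts freeness. *)
pose d i : k := \sum_(j <- s | (j.1 == g0) && (j.2 == i)) c j.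
have d0 : d i0 = 0.
  rewrite /d big_seq_cond big1 // => -[g i] /= /and3P[gis /eqP gg /eqP ii].
  by rewrite -gg -ii gis in js.
have := v_free (fun i => d i - (i == i0)%:R).
rewrite (_ : \sum_i _ = 0) => [/(_ erefl i0)|].
  by rewrite d0 eqxx sub0r => /eqP; rewrite oppr_eq0 oner_eq0.
under eq_bigr do rewrite scalerBl scalerBl.
rewrite sumrB [X in _ - X](bigD1 i0) //=.
rewrite [X in _ - (_ + X)]big1 => [|i /negbTE ->].
  rewrite eqxx scale1r scale1r addr0 {1}vi0.
  apply/eqP; rewrite subr_eq0; apply/eqP.
  rewrite -big_mkcond /= (partition_big (fun j : gT * 'I_n => j.2) xpredT) //=.
  apply: eq_bigr => i _; rewrite scaler_suml scaler_suml.
  by apply: eq_bigr => j /andP[_ /eqP ->].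
by rewrite scale0r scale0r.
Qed.

End TwistedSimples.

(** * Quotients by left ideals and the radical *)

Section Subspaces.
Variables (k : fieldType) (vT : vectType k).

Lemma max_dim_vspace (C : {vspace vT} -> Prop) : (exists U, C U) ->
  exists2 U, C U & forall W, C W -> (\dim W <= \dim U)%N.
Proof.
move=> [U0 CU0].
have ex : exists n, `[< exists2 U, C U & \dim U = n >].
  by exists (\dim U0); apply/asboolP; exists U0.
have bd n : `[< exists2 U, C U & \dim U = n >] -> (n <= \dim {:vT})%N.
  by move=> /asboolP[U _ <-]; apply/dimvS/subvf.
case: (ex_maxnP ex bd) => n /asboolP[U CU <-] mU.
by exists U => // W CW; apply: mU; apply/asboolP; exists W.
Qed.

(** A subspace of largest dimension inside [L] exhausts it, since adjoining a vector of [L] cannot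
    enlarge it. *)
Lemma vspace_of_pred (L : {pred vT}) :
  submod_closed L -> exists U : {vspace vT}, forall x, (x \in U) = (x \in L).
Proof.
move=> [L0 LP].
have [|U UL Umax] := @max_dim_vspace (fun U => {subset U <= L}).
  by exists 0%VS => x; rewrite memv0 => /eqP ->.
exists U => x; apply/idP/idP => [/UL //|xL].
have UxL : {subset (U + <[x]>)%VS <= L}.
  move=> _ /memv_addP[u uU [_ /vlineP[c ->] ->]].
  rewrite addrC; exact: LP xL (UL u uU).
suff -> : U = (U + <[x]>)%VS by rewrite (subvP (addvSr U _)) ?memv_line.
by apply/eqP; rewrite eqEdim addvSl Umax.
Qed.

Lemma has_dim_inj (W : lmodType k) (f : {linear W -> vT}) :
  injective f -> exists n, has_dim n W.
Proof.
move=> f_inj.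
have T0 : submod_closed (@predT W) by [].
have [U UE] := vspace_of_pred (submod_closed_im f T0).
have fU w : f w \in U by rewrite UE inE; apply/asboolP; exists w.
have /choice[g gE] : forall u : subvs_of U, exists w, f w = vsval u.
  by move=> u; have := subvsP u; rewrite UE inE => /asboolP[w _ wE]; exists w.
have vU w : vsval (vsproj U (f w)) = f w by rewrite vsprojK.
exists (dim (subvs_of U)); constructor; exists (v2r \o vsproj U \o f).
  by move=> a x y /=; rewrite !linearP.
exists (g \o r2v) => [w|r] /=; first by apply: f_inj; rewrite v2rK gE vU.
by rewrite gE vsvalK r2vK.
Qed.
End Subspaces.

Section QuotientModule.
Variables (k : fieldType) (R : falgType k) (M : {vspace R}).

(* The quotient [R / M], carried by a complement of the left ideal [M]. *)
Definition quot_mod & (forall r m, m \in M -> r * m \in M) : Type :=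
  subvs_of (M^C)%VS.

Hypothesis MP : forall r m, m \in M -> r * m \in M.
Local Notation Q := (quot_mod MP).
HB.instance Definition _ := GRing.Zmodule.on Q.

Definition quot_proj (x : R) : Q := vsproj (M^C)%VS (x - projv M x).
Let rep (q : Q) : R := vsval q.

Fact quot_proj_zmod : zmod_morphism quot_proj.
Proof.
move=> x y; rewrite /quot_proj -raddfB; congr (vsproj _ _).
by rewrite raddfB /= !opprB addrACA [RHS]addrACA (addrC (- y)).
Qed.
HB.instance Definition _ :=
  GRing.isZmodMorphism.Build R Q quot_proj quot_proj_zmod.

Lemma quot_proj_eq0 x : (quot_proj x == 0) = (x \in M).
Proof.
apply/eqP/idP => [x0|xM]; last by rewrite /quot_proj projv_id // subrr linear0.
have := vsprojK (memv_projC M x); rewrite -/(quot_proj x) x0 => /esym/eqP.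
by rewrite linear0 subr_eq0 => /eqP ->; apply: memv_proj.
Qed.

Lemma quot_projK q : quot_proj (rep q) = q.
Proof.
have repC : rep q \in (M^C)%VS := subvsP q.
rewrite /quot_proj (_ : projv M _ = 0) ?subr0 /rep ?vsvalK //.
by apply/eqP; rewrite -memv_ker lker_proj.
Qed.

Lemma quot_proj_mul r x : quot_proj (r * rep (quot_proj x)) = quot_proj (r * x).
Proof.
apply/eqP; rewrite -subr_eq0 -raddfB quot_proj_eq0 -mulrBr MP //.
by rewrite -quot_proj_eq0 raddfB /= quot_projK subrr.
Qed.

Definition quot_scale (r : R) (q : Q) : Q := quot_proj (r * rep q).
Fact quot_scaleA a b v : quot_scale a (quot_scale b v) = quot_scale (a * b) v.
Proof. by rewrite /quot_scale quot_proj_mul mulrA. Qed.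
Fact quot_scale1 : left_id 1 quot_scale.
Proof. by move=> v; rewrite /quot_scale mul1r quot_projK. Qed.
Fact quot_scaleDr : right_distributive quot_scale +%R.
Proof. by move=> a u v; rewrite /quot_scale -raddfD -mulrDr. Qed.
Fact quot_scaleDl v : {morph quot_scale^~ v : a b / a + b}.
Proof. by move=> a b; rewrite /quot_scale -raddfD -mulrDl. Qed.
HB.instance Definition _ := GRing.Zmodule_isLmodule.Build R Q
  quot_scaleA quot_scale1 quot_scaleDr quot_scaleDl.

Lemma quot_proj_scale r x : quot_proj (r * x) = r *: quot_proj x.
Proof. by rewrite -quot_proj_mul. Qed.

(** A submodule of the quotient pulls back to a left ideal [W] containing [M]: either [W] contains
    1, or maximality of the dimension forces [W = M]. *)
Lemma quot_simple : 1 \notin M ->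
    (forall W : {vspace R}, (forall r m, m \in W -> r * m \in W) ->
       (M <= W)%VS -> 1 \notin W -> (\dim W <= \dim M)%N) ->
  simple_mod Q.
Proof.
move=> M1 Mmax; split; first by exists (quot_proj 1); rewrite quot_proj_eq0.
move=> N [N0 NP].
have cW : submod_closed [pred x : R | quot_proj x \in N].
  split=> [|a x y]; rewrite !inE ?raddf0 // => xN yN.
  by rewrite -mulr_algl raddfD /= quot_proj_scale NP.
have [W WE] := vspace_of_pred cW.
have [W1|W1] := boolP (1 \in W).
  right=> q; rewrite inE /= -[q]quot_projK -[rep q]mulr1 quot_proj_scale.
  by rewrite -[_ *: _]addr0 NP // -[_ \in N]WE.
left=> q; rewrite inE; have MW : (M <= W)%VS.
  by apply/subvP=> x; rewrite WE inE -quot_proj_eq0 => /eqP ->.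
have -> : (q \in N) = (rep q \in W) by rewrite WE inE quot_projK.
suff /eqP <- : M == W by rewrite -quot_proj_eq0 quot_projK.
rewrite eqEdim MW Mmax // => r m; rewrite !WE !inE quot_proj_scale => mN.
by rewrite -[_ *: _]addr0 NP.
Qed.
End QuotientModule.

Section Radical.
Variables (k : closedFieldType) (R : falgType k) (gT : finGroupType).
Variables (tau : algaction gT R) (V : lmodType R).
Hypothesis V_twists : complete_simples (fun g : gT => twist tau g V).

(** A form of Nakayama's lemma. A proper [L] lies in a maximal left ideal [M], and [R / M] is
    isomorphic to a twist. An element [1 - l] killing all twists then lies in [M], and so does 1. *)
Lemma twist_annihilator_superfluous (L : {pred R}) : left_ideal L ->
    (forall r, exists2 l, l \in L &
       forall g (x : V), tau g^-1%g (r - l) *: x = 0) ->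
  L =i predT.
Proof.
move=> [L0 LP] LT.
have LM r l : l \in L -> r * l \in L by move=> lL; rewrite -[_ * _]addr0 LP.
suff L1 : 1 \in L by move=> r; rewrite -[r]mulr1 LM.
apply: contraT => nL1.
have [U UE] : exists U : {vspace R}, forall x, (x \in U) = (x \in L).
  apply: vspace_of_pred; split=> // a x y xL yL.
  by rewrite -mulr_algl; apply: LP.
have [|M [MP LM1 M1] Mmax] := @max_dim_vspace k R (fun M => [/\
    forall r m, m \in M -> r * m \in M, {subset L <= M} & 1 \notin M]).
  by exists U; split=> [r m|x|]; rewrite !UE //; apply: LM.
have sQ : simple_mod (quot_mod MP).
  apply: quot_simple => // W WP MW W1; apply: Mmax; split=> // x xL.
  exact/(subvP MW)/LM1.
have [_ _ /(_ _ sQ)[g [f [f' fK _]]]] := V_twists.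
have [l lL lP] := LT 1.
suff M1l : 1 - l \in M.
  by case/negP: M1; rewrite -[1](subrK l); apply: memvD M1l (LM1 l lL).
rewrite -quot_proj_eq0 -[1 - l]mulr1 quot_proj_scale; apply/eqP/(can_inj fK).
by rewrite linear0 linearZ_LR /=; apply: lP.
Qed.
End Radical.

(** * Progenerators and matrix algebras *)

Section FreeSum.
Variables (R : nzRingType) (M : lmodType R) (I : finType).
Local Notation MI := {ffun I -> M}.

Definition ffun_inc (i : I) (x : M) : MI := [ffun j => if j == i then x else 0].
Fact ffun_inc_linear i : linear (ffun_inc i).
Proof.
move=> a x y; apply/ffunP=> j; rewrite !ffunE.
by case: (j == i); rewrite ?scaler0 ?addr0.
Qed.
HB.instance Definition _ i :=
  GRing.isLinear.Build R M MI *:%R (ffun_inc i) (ffun_inc_linear i).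

Definition ffun_prj (i : I) (q : MI) : M := q i.
Fact ffun_prj_linear i : linear (ffun_prj i).
Proof. by move=> a x y; rewrite /ffun_prj !ffunE. Qed.
HB.instance Definition _ i :=
  GRing.isLinear.Build R MI M *:%R (ffun_prj i) (ffun_prj_linear i).

Lemma ffun_biproduct q : \sum_i ffun_inc i (ffun_prj i q) = q.
Proof.
apply/ffunP=> j; rewrite sum_ffunE (bigD1 j) //= big1 ?addr0 => [|i ij].
  by rewrite ffunE eqxx.
by rewrite ffunE eq_sym (negbTE ij).
Qed.
End FreeSum.

Section MatrixOfRegular.
Variables (k : nzRingType) (R : algType k) (M : lmodType R) (n : nat).
Hypothesis M_neq0 : exists x : M, x != 0.
Local Notation Mn := {ffun 'I_n.+1 -> M}.
Local Notation S := ((endalg M_neq0)^c).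

Variables (w : Mn) (Psi : Mn -> R).
Hypothesis PsiK : forall q, Psi q *: w = q.
Hypothesis KPsi : forall r, Psi (r *: w) = r.

Let PsiP a x y : Psi (a *: x + y) = a * Psi x + Psi y.
Proof. by rewrite -{1}(PsiK x) -{1}(PsiK y) scalerA -scalerDl KPsi. Qed.

(** With [R] identified with [Mn] through [w] and [Psi], this is the component from summand [i] to
    summand [j] of right multiplication by [r]. *)
Definition regular_entry_fun (r : R) (i j : 'I_n.+1) (x : M) : M :=
  ((Psi (ffun_inc i x) * r) *: w) j.
Fact regular_entry_linear r i j : linear (regular_entry_fun r i j).
Proof.
move=> a x y; rewrite /regular_entry_fun linearP PsiP mulrDl scalerDl ffunE.
by rewrite -mulrA -scalerA !ffunE.
Qed.
HB.instance Definition _ r i j := GRing.isLinear.Build R M M *:%R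
  (regular_entry_fun r i j) (regular_entry_linear r i j).
Definition regular_entry r i j : endalg M_neq0 :=
  (regular_entry_fun r i j : {linear M -> M}).

Lemma regular_entryE r i j x :
  endfun (regular_entry r i j) x = ((Psi (ffun_inc i x) * r) *: w) j.
Proof. by []. Qed.

Lemma sum_regular_entry r j (q : Mn) :
  \sum_i endfun (regular_entry r i j) (q i) = ((Psi q * r) *: w) j.
Proof.
have Psi_add : {morph Psi : x y / x + y}.
  by move=> x y; rewrite -[x]scale1r PsiP mul1r scale1r.
have Psi0 : Psi 0 = 0 by rewrite -[0 in LHS](scale0r w) KPsi.
rewrite -[in RHS](ffun_biproduct q) (big_morph Psi Psi_add Psi0).
by rewrite mulr_suml scaler_suml sum_ffunE.
Qed.

Lemma end_sumE (I : finType) (F : I -> endalg M_neq0) x :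
  endfun (\sum_i F i) x = \sum_i endfun (F i) x.
Proof. exact: (big_morph (fun f : endalg M_neq0 => endfun f x)). Qed.

(** [R] is the opposite of the endomorphism ring of its regular module, here [Mn]. Right
    multiplications compose in reverse order, whence the opposite ring in [S]. *)
Theorem regular_matalg : alg_iso R (matalg S n).
Proof.
pose f (r : R) : matalg S n := \matrix_(i, j) (regular_entry r i j : S).
(* A right multiplication is recovered from the image of 1, which corresponds to [w]. *)
pose g (N : matalg S n) : R :=
  Psi [ffun j => \sum_i endfun (N i j : endalg M_neq0) (w i)].
apply: (@alg_isoI k R (matalg S n) f g).
- move=> r s; apply/matrixP=> i j; rewrite !mxE; apply: (@endP k R M) => x.
  rewrite [LHS]regular_entryE mulrBr scalerBl ffunE [X in _ + X]ffunE.
  by [].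
- split=> [|r s]; apply/matrixP=> i j; rewrite !mxE; apply: (@endP k R M) => x.
    rewrite regular_entryE mulr1 PsiK ffunE [j == i]eq_sym.
    by case: (i == j).
  rewrite regular_entryE mulrA.
  transitivity (\sum_l endfun (regular_entry s l j)
      (endfun (regular_entry r i l) x)).
    under eq_bigr do rewrite [endfun (regular_entry r i _) x]regular_entryE.
    by rewrite sum_regular_entry KPsi.
  rewrite [RHS](end_sumE); apply: eq_bigr => l _.
  by rewrite !mxE.
- move=> c r; apply/matrixP=> i j; rewrite !mxE; apply: (@endP k R M) => x.
  rewrite [LHS]regular_entryE -scalerAr -mulr_algl -scalerA ffunE.
  by [].
- move=> r; rewrite /g -[RHS]KPsi; congr Psi; apply/ffunP=> j; rewrite ffunE.
  under eq_bigr do rewrite mxE.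
  by rewrite sum_regular_entry -{1}[w]scale1r KPsi mul1r.
- move=> N; apply/matrixP=> i j; rewrite mxE; apply: (@endP k R M) => x.
  rewrite regular_entryE -scalerA PsiK ffunE.
  have sw : Psi (ffun_inc i x) *: w = ffun_inc i x by [].
  rewrite !ffunE scaler_sumr (bigD1 i) //= big1 ?addr0 => [|l li].
    by rewrite -linearZ; move/ffunP: sw => /(_ i); rewrite !ffunE eqxx => ->.
  rewrite -linearZ; move/ffunP: sw => /(_ l); rewrite !ffunE (negbTE li) => ->.
  exact: linear0.
Qed.
End MatrixOfRegular.

(** * Sums of twists and scalar local algebras *)

(** A left ideal not inside the kernel of [f] contains a left-invertible element and is everything,
    so the kernel is the only maximal left ideal. *)
Lemma scalar_local_criterion (k : fieldType) (A : algType k)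
    (f : {lrmorphism A -> k^o}) n :
  has_dim n A -> (forall a, f a != 0 -> exists b, b * a = 1) -> scalar_local A.
Proof.
move=> dA unitA; pose I : {pred A} := [pred a | f a == 0].
have I1 : 1 \notin I by rewrite inE rmorph1 oner_eq0.
have unitT (J : {pred A}) a :
    left_ideal J -> a \in J -> a \notin I -> J =i predT.
  move=> [J0 JP] aJ /unitA[b ba] x; rewrite -[x]mulr1 -ba mulrA.
  by rewrite -[_ * a]addr0; apply: (JP (x * b) a 0).
have IL : left_ideal I.
  split=> [|a x y]; rewrite !inE ?rmorph0 // => /eqP fx /eqP fy.
  by rewrite raddfD /= rmorphM /= fx fy mulr0 addr0.
have Imax : maximal_left_ideal I.
  split=> // [IT|J JL IJ]; first by rewrite IT in I1.
  have [[a aJ aI]|JI] := pselect (exists2 a, a \in J & a \notin I).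
    by right; apply: unitT aI.
  left=> a; apply/idP/idP=> [aJ|/IJ //].
  by apply: contra_notT JI => aI; exists a.
have Iuniq J : maximal_left_ideal J -> J =i I.
  move=> [JL JT Jmax]; have JI : {subset J <= I}.
    move=> a aJ; apply: contra_notT JT => aI; exact: unitT aI.
  have [//|IT] := Jmax I IL JI; first by move=> a.
  by rewrite IT in I1.
split; [by exists n | by exists I | exists f; split=> [c|a]].
  by exists (c *: 1); rewrite linearZ rmorph1 /= -[LHS]/(c * 1) mulr1.
split=> [fa J /Iuniq ->|/(_ I Imax)]; first by rewrite inE fa.
by rewrite inE => /eqP.
Qed.

Lemma fixed_inverse (k : nzRingType) (gT : finGroupType) (A : algType k)
    (alpha : algaction gT A) (a b : A) :
  a \in fixed_pred alpha -> b * a = 1 -> a * b = 1 -> b \in fixed_pred alpha.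
Proof.
rewrite !inE => /forallP fa ba ab; apply/forallP=> g; apply/eqP.
rewrite -[LHS]mulr1 -{1}ab mulrA -{1}(eqP (fa g)).
by rewrite -rmorphM ba rmorph1 mul1r.
Qed.

(** The image of [f] and [K] span [M], so [f] is onto; projectivity then lifts the identity of
    [M]. *)
Lemma superfluous_section (R : nzRingType) (M N : lmodType R) (K : {pred M})
    (f : {linear N -> M}) :
  projective M -> superfluous K -> (forall m, exists n, m - f n \in K) ->
  exists l : {linear M -> N}, forall m, f (l m) = m.
Proof.
move=> pM sK fK; have f_surj : surjective f.
  have T0 : submod_closed (@predT N) by [].
  have imT : [pred y | `[< exists2 x, x \in predT & f x = y >]] =i predT.
    apply: sK (submod_closed_im f T0) _ => m.
    have [n nK] := fK m; exists (m - f n), (f n).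
    split=> //; last by rewrite subrK.
    by rewrite inE; apply/asboolP; exists n.
  by move=> m; have := imT m; rewrite !inE => /asboolP[n _ <-]; exists n.
have [l lE] := pM N M f idfun f_surj.
by exists l => m; have := lE m.
Qed.

Section Twists.
Variables (k : nzRingType) (gT : finGroupType) (R : algType k).
Variables (tau : algaction gT R).

(** Twisting source and target by [g^-1] turns the lifting problem into one for [P]. *)
Lemma twist_projective g (P : lmodType R) :
  projective P -> projective (twist tau g P).
Proof.
move=> pP M N f h f_surj.
have [|f' f'E] := @linearI R (twist tau g^-1%g M) (twist tau g^-1%g N) f.
  by move=> a x y; rewrite linearP.
have [|h' h'E] := @linearI R P (twist tau g^-1%g N) h.
  move=> a x y; rewrite [RHS]/(_ *: _ + _) /=.
  rewrite -[RHS]/(tau g^-1^-1%g a *: (h x : N) + h y) -linearP.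
  congr (h (_ + _)).
  by rewrite -[RHS]/(tau g^-1%g (tau g^-1^-1%g a) *: (x : P)) (actVK tau).
have [|l lE] := pP _ _ f' h'.
  by move=> n; have [m fm] := f_surj n; exists m; rewrite f'E.
have [|L LE] := @linearI R (twist tau g P) M l.
  move=> a x y; rewrite -[a *: x]/(tau g^-1%g a *: (x : P)) linearP.
  congr (_ + _); rewrite -[LHS]/(tau g^-1^-1%g (tau g^-1%g a) *: (l x : M)).
  by rewrite (Defs.actK tau).
by exists L => x /=; rewrite LE -h'E -f'E; apply: lE.
Qed.

Lemma twist_superfluous g (P : lmodType R) (N : {pred P}) :
  superfluous N -> superfluous (N : {pred twist tau g P}).
Proof.
move=> sN L [L0 LP] NL; apply: (sN (L : {pred P})) => //.
split=> // a x y xL yL.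
rewrite (_ : a *: x = tau g a *: (x : twist tau g P)); first exact: LP.
by rewrite -[RHS]/(tau g^-1%g (tau g a) *: (x : P)) (Defs.actK tau).
Qed.

Section Sum.
Variable P : lmodType R.
Local Notation Q := (twist_sum tau P).

Definition sum_inc (g : gT) (x : twist tau g P) : Q :=
  [ffun h => if h == g then (x : P) else 0].
Fact sum_inc_linear g : linear (@sum_inc g).
Proof.
move=> a x y; apply/ffunP=> h; rewrite !ffunE.
case: eqP => [->//|_]; by rewrite scaler0 addr0.
Qed.
HB.instance Definition _ g := GRing.isLinear.Build R (twist tau g P) Q *:%R
  (@sum_inc g) (@sum_inc_linear g).

Definition sum_prj (g : gT) (q : Q) : twist tau g P := q g.
Fact sum_prj_linear g : linear (@sum_prj g).
Proof. by move=> a x y; rewrite /sum_prj !ffunE. Qed.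
HB.instance Definition _ g := GRing.isLinear.Build R Q (twist tau g P) *:%R
  (@sum_prj g) (@sum_prj_linear g).

Lemma sum_biproduct q : \sum_g sum_inc (sum_prj g q) = q.
Proof.
apply/ffunP=> h; rewrite sum_ffunE (bigD1 h) //= big1 ?addr0 => [|g gh].
  by rewrite ffunE eqxx.
by rewrite ffunE eq_sym (negbTE gh).
Qed.

Lemma psi_sum_inc g h (x : P) :
  psi g (sum_inc (x : twist tau h P)) = sum_inc (x : twist tau (g * h)%g P).
Proof.
apply/ffunP=> m; rewrite !ffunE.
by rewrite -(inj_eq (mulgI g)) mulKVg.
Qed.
End Sum.
End Twists.

(** * The sum of the twists of a projective cover *)

Section CoverSum.
Variables (k : closedFieldType) (R : falgType k) (gT : finGroupType).
Variables (tau : algaction gT R) (V : lmodType R) (t : nat).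
Variables (P : lmodType R) (p : {linear P -> V}).
Hypothesis V_simple : simple_mod V.
Hypothesis V_twists : complete_simples (fun g : gT => twist tau g V).
Hypothesis V_dim : has_dim t.+1 (restr V).
Hypothesis P_cover : projective_cover p.

Let P_neq0 := projective_cover_neq0 V_simple P_cover.
Local Notation Q := (twist_sum tau P).
Local Notation S := (basic_alg tau P_neq0).
Local Notation act := (basic_action tau P_neq0).

Local Notation ev phi :=
  (endfun ((phi : S) : endalg (twist_sum_neq0 tau P_neq0))).

Definition sum_ker : {pred Q} := [pred q : Q | [forall g, p (q g) == 0]].

Lemma sum_kerP (q : Q) : reflect (forall g, p (q g) = 0) (q \in sum_ker).
Proof. by rewrite inE; apply: (iffP forallP) => H g; apply/eqP. Qed.

Lemma sum_projective : projective Q.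
Proof.
have [pP _ _] := P_cover.
apply: (@projective_biproduct R Q gT (fun g => twist tau g P)
  (@sum_inc k gT R tau P) (@sum_prj k gT R tau P)
  (@sum_biproduct k gT R tau P)) => g.
exact: twist_projective.
Qed.

Lemma sum_ker_superfluous : superfluous sum_ker.
Proof.
have [_ _ sp] := P_cover.
apply: (@superfluous_biproduct R Q gT (fun g => twist tau g P)
  (@sum_inc k gT R tau P) (@sum_prj k gT R tau P) (@sum_biproduct k gT R tau P)
  (fun=> [pred x : P | p x == 0])) => g.
  split=> [|a x y]; rewrite !inE ?linear0 // => /eqP px /eqP py.
  by rewrite linearP px py scaler0 addr0.
exact: twist_superfluous.
Qed.

Lemma cover_hom h (f : {linear P -> twist tau h V}) :
  exists c : k, forall x, f x = if h == 1%g then (c%:A : R) *: p x else 0.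
Proof.
have [pP p_surj sp] := P_cover; have [sV _ _] := V_twists.
have fp x : p x = 0 -> f x = 0.
  move=> px; apply: (superfluous_ker_hom f sp (submod_closed_ker p) (sV h)).
  by rewrite inE px.
have [e eE] := hom_factor p_surj fp.
(* [V] and its twist by 1 have equal but not convertible scalar actions, so [e] is bundled again. *)
have [|e1 e1E] := @linearI R (twist tau 1%g V) (twist tau h V) e.
  move=> a x y; rewrite -[a *: x]/(tau 1^-1%g a *: (x : V)) invg1 act_id.
  exact: linearP.
have [h1|h1] := eqVneq.
  subst h.
  have [c cE] := twist_hom_scalar V_twists V_dim e1.
  by exists c => x; rewrite eE -e1E cE.
exists 0 => x; rewrite eE -e1E; apply: (twist_hom_neq0 V_twists).
by rewrite eq_sym.
Qed.

Lemma fixed_commutes (phi : S) g (q : Q) : phi \in fixed_pred act ->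
  ev phi (psi g q) = psi g (ev phi q).
Proof.
rewrite inE => /forallP/(_ g)/eqP phi_fix.
rewrite -{1}phi_fix -[LHS]/(psi g (ev phi (psi g^-1%g (psi g q)))).
by rewrite psiK.
Qed.

Lemma fixed_scalar (phi : S) : phi \in fixed_pred act ->
  exists c : k, forall (q : Q) h, p (ev phi q h) = (c%:A : R) *: p (q h).
Proof.
move=> phi_fix; pose F := ev phi.
have coverF h : exists c : k, forall x : P,
    p (F (sum_inc (x : twist tau 1%g P)) h) =
    if h == 1%g then (c%:A : R) *: p x else 0.
  have [|f fE] := @linearI R P (twist tau h V)
      (fun x => p (F (sum_inc (x : twist tau 1%g P)) h)).
    move=> a x y.
    have -> : a *: x + y = a *: (x : twist tau 1%g P) + y.
      by congr (_ + _); rewrite -[RHS]/(tau 1^-1%g a *: x) invg1 act_id.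
    by rewrite !linearP !ffunE linearP.
  have [c cE] := cover_hom f.
  by exists c => x; rewrite -fE cE.
have [c cE] := coverF 1%g.
exists c => q h.
rewrite -/F -[q in LHS]sum_biproduct raddf_sum sum_ffunE raddf_sum.
(* By invariance, the component from position [g] to [h] equals that from [1] to [g^-1 * h]:
   off-diagonal components vanish modulo the kernel, and all diagonal ones share the scalar [c]. *)
have FE g (x : P) : F (sum_inc (x : twist tau g P)) h =
    F (sum_inc (x : twist tau 1%g P)) (g^-1 * h)%g.
  rewrite -[LHS]/(F (@sum_inc k gT R tau P g x) h) -{1}[g]mulg1.
  by rewrite -(psi_sum_inc tau g) [F _]fixed_commutes // ffunE.
rewrite (bigD1 h) //= big1 ?addr0 => [|g gh].
  by rewrite FE mulVg cE eqxx.
rewrite FE; have [d ->] := coverF (g^-1 * h)%g.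
by rewrite -eq_mulVg1 (negbTE gh).
Qed.

Lemma scalar_inj (c d : k) (v : V) :
  v != 0 -> (c%:A : R) *: v = (d%:A : R) *: v -> c = d.
Proof.
move=> v0 /eqP; rewrite -subr_eq0 -!scalerBl => cdv.
apply/eqP; apply: contraNT v0; rewrite -subr_eq0 => cd.
have := congr1 (fun x => ((c - d)^-1%:A : R) *: x) (eqP cdv).
by rewrite scaler0 scalerA -scalerAl mul1r scalerA mulVf // !scale1r => ->.
Qed.

Lemma scalarVK (c : k) (v : V) :
  c != 0 -> (c^-1%:A : R) *: ((c%:A : R) *: v) = v.
Proof.
by move=> c0; rewrite scalerA -scalerAl mul1r scalerA mulVf // !scale1r.
Qed.

Lemma residue_exists : exists f : {lrmorphism fixalg act -> k^o},
  forall phi (q : Q) h,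
    p (ev (fixval phi) q h) = ((f phi : k)%:A : R) *: p (q h).
Proof.
have /choice[f fP] (phi : fixalg act) := fixed_scalar (valP phi).
have [[v v0] _] := V_simple.
have [_ p_surj _] := P_cover; have [x px] := p_surj v.
pose q0 : Q := sum_inc (x : twist tau 1%g P).
have pq0 : p (q0 1%g) = v by rewrite ffunE eqxx px.
have f_uniq phi (c : k) : (forall q : Q, p (ev (fixval phi) q 1%g) =
    (c%:A : R) *: p (q 1%g)) -> f phi = c.
  by move=> cP; apply: (scalar_inj v0); rewrite -pq0 -fP cP.
have evB (a b : S) q : ev (a - b) q = ev a q - ev b q by [].
have evZ c (a : S) q : ev (c *: a) q = (c%:A : R) *: ev a q by [].
(* Products in [S] are reversed compositions; this is harmless for the residue map, since [k] is
   commutative. *)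
have evM (a b : S) q : ev (a * b) q = ev b (ev a q) by [].
have fB : zmod_morphism (f : fixalg act -> k^o).
  move=> a b; apply: f_uniq => q.
  rewrite fixvalB evB ffunE [X in _ + X]ffunE.
  by rewrite raddfB /= !fP -scalerBl -scalerBl.
have fM : monoid_morphism (f : fixalg act -> k^o).
  split=> [|a b]; apply: f_uniq => q; first by rewrite !scale1r.
  rewrite fixvalM evM !fP.
  by rewrite scalerA -scalerAl mul1r scalerA mulrC.
have fZ : scalable (f : fixalg act -> k^o).
  move=> c a; apply: f_uniq => q.
  rewrite fixvalZ evZ ffunE twist_scaleE act_scalar.
  by rewrite linearZ /= fP scalerA -scalerAl mul1r scalerA.
pose aB := GRing.isZmodMorphism.Build (fixalg act) k^o f fB.
pose aM := GRing.isMonoidMorphism.Build (fixalg act) k^o f fM.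
pose aZ := GRing.isScalable.Build k (fixalg act) k^o *:%R f fZ.
pose F : {lrmorphism fixalg act -> k^o} := HB.pack f aB aM aZ.
by exists F.
Qed.

Lemma scalar_section (f : {linear Q -> Q}) (c : k) : c != 0 ->
    (forall (q : Q) h, p (f q h) = (c%:A : R) *: p (q h)) ->
  exists l : {linear Q -> Q}, forall q, f (l q) = q.
Proof.
move=> c0 fc.
apply: (superfluous_section sum_projective sum_ker_superfluous) => q.
exists ((c^-1%:A : R) *: q); apply/sum_kerP => h.
rewrite linearZ /= !ffunE twist_scaleE act_scalar raddfB /= linearZ /= fc.
by rewrite scalarVK // subrr.
Qed.

(** A section [l] of [phi] induces the scalar [c^-1], so it has a section too; hence [l] is a
    two-sided inverse, and it is fixed because [phi] is. *)
Lemma fixed_unit (phi : fixalg act) (c : k) : c != 0 ->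
    (forall (q : Q) h, p (ev (fixval phi) q h) = (c%:A : R) *: p (q h)) ->
  exists psi : fixalg act, psi * phi = 1.
Proof.
move=> c0 phic; have [l lK] := scalar_section c0 phic.
have [|q h|l' l'K] := @scalar_section l c^-1; first by rewrite invr_eq0.
  by rewrite -{2}[q]lK phic scalarVK.
have Kl q : l (ev (fixval phi) q) = q by rewrite -{1}[q]l'K lK l'K.
have lphi : (l : S) * fixval phi = 1.
  by apply: (@endP k R Q) => q; apply: lK.
have bP : (l : S) \in fixed_pred act.
  apply: (@fixed_inverse k gT S act (fixval phi) l) => //; first exact: valP.
  by apply: (@endP k R Q) => q; apply: Kl.
by exists (FixAlg bP); apply: val_inj; rewrite [LHS]fixvalM [RHS]fixval1.
Qed.

Lemma sum_idempotents_skew_group :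
    abelian [set: gT] -> (#|gT|%:R : k) != 0 ->
  exists beta : algaction gT (fixalg act), alg_iso S (skew_group beta).
Proof.
move=> abG cardG.
pose e g : S := (sum_inc (g := g) \o sum_prj g : {linear Q -> Q}).
have eE g (q : Q) h : ev (e g) q h = if h == g then q h else 0.
  by rewrite /= ffunE; case: eqP => [->|].
apply: (@regular_idempotents_skew_group k gT S act e abG cardG).
- move=> g h; apply: (@endP k R Q) => q; apply/ffunP => m.
  rewrite -[LHS]/(ev (e h) (ev (e g) q) m) !eE.
  have [->|gh] := eqVneq g h; first by rewrite scale1r eE; case: (m == h).
  rewrite scale0r -[ev 0 q]/(0 : Q) [RHS]ffunE; case: eqP => // ->.
  by rewrite eq_sym (negbTE gh).
- apply: (@endP k R Q) => q; rewrite [LHS](end_sumE (M := Q)).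
  exact: sum_biproduct.
- move=> g h; apply: (@endP k R Q) => q; apply/ffunP => m.
  rewrite -[LHS]/(psi h (ev (e g) (psi h^-1%g q)) m) eE ffunE eE ffunE.
  by rewrite invgK mulKVg -(inj_eq (mulgI h)) mulKVg.
Qed.

Lemma cover_matalg : alg_iso R (matalg S t).
Proof.
have [v [v_span v_free]] := has_dim_basis V_dim.
have [_ p_surj _] := P_cover.
have /choice[x xP] : forall i, exists x, p x = v i by move=> i; apply: p_surj.
pose M := {ffun 'I_t.+1 -> Q}.
(* Each coordinate is a constant tuple: [r] acts on its entry at [g] through [tau g^-1], as in
   [twist_density]. *)
pose w : M := [ffun i => [ffun g => x i] : Q].
have wE r i g : (r *: w) i g = tau g^-1%g r *: x i by rewrite !ffunE.
have pM : projective M.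
  apply: (@projective_biproduct R M 'I_t.+1 (fun=> Q) (@ffun_inc R Q _)
    (@ffun_prj R Q _) (@ffun_biproduct R Q _)) => _.
  exact: sum_projective.
pose K : {pred M} := [pred m : M | [forall i, m i \in sum_ker]].
have sK : superfluous K.
  apply: (@superfluous_biproduct R M 'I_t.+1 (fun=> Q) (@ffun_inc R Q _)
    (@ffun_prj R Q _) (@ffun_biproduct R Q _) (fun=> sum_ker)) => _.
    split=> [|a q q' /sum_kerP qK /sum_kerP qK']; apply/sum_kerP => g.
      by rewrite ffunE linear0.
    by rewrite !ffunE raddfD /= qK' addr0 twist_scaleE linearZ /= qK scaler0.
  exact: sum_ker_superfluous.
have [|h hE] := @linearI R R^o M (fun r => (r : R) *: w).
  by move=> a r r'; rewrite scalerDl scalerA.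
have [m|l lK] := superfluous_section (f := h) pM sK.
  have [r rP] := twist_density V_twists V_dim v_free (fun g i => p (m i g)).
  exists r; rewrite inE; apply/forallP => i; apply/sum_kerP => g.
  rewrite hE ffunE [X in _ + X]ffunE ffunE [X in _ + X]ffunE.
  by rewrite raddfB /= wE linearZ /= xP rP subrr.
have lw q : (l q : R) *: w = q by rewrite -[LHS]hE lK.
(* The image of the section is a left ideal, and [r - l (r *: w)] kills [w], hence the basis [v] in
   every twist. So [l] is onto and inverse to [r |-> r *: w]. *)
have LT : [pred r | `[< exists2 q, q \in predT & l q = r >]] =i predT.
  apply: (twist_annihilator_superfluous V_twists).
    exact: submod_closed_im.
  move=> r; exists (l (r *: w)).
    by rewrite inE; apply/asboolP; exists (r *: w).
  move=> g y; have [c ->] := v_span y.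
  rewrite scaler_sumr big1 // => i _.
  rewrite -[X in _ *: X]/((c i)%:A *: v i) scalerA -scalar_central -scalerA.
  rewrite -xP -linearZ /= -wE scalerBl lw subrr !ffunE.
  by rewrite linear0 scaler0.
have lwK r : l (r *: w) = r.
  by have := LT r; rewrite !inE => /asboolP[q _ <-]; rewrite lw.
exact: (regular_matalg _ lw lwK).
Qed.

Lemma fixed_scalar_local : scalar_local (fixalg act).
Proof.
have [f fP] := residue_exists.
have [g [g' gK _]] := alg_iso_sym cover_matalg; have g_inj := can_inj gK.
(* Finite dimension of the fixed algebra: it embeds in [R] through scalar matrices over [S]. *)
have [|i iE] :=
  @linearI k (fixalg act) R (fun s => g (scalar_mx (fixval s : S))).
  move=> c a b; rewrite -linearP; congr (g _).
  apply/matrixP => i j; rewrite !mxE /=; case: (i == j); rewrite ?mulr1n //.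
  by rewrite !mulr0n scaler0 addr0.
have [|n dn] := @has_dim_inj k R (fixalg act) i.
  move=> a b; rewrite !iE => /g_inj/matrixP/(_ ord0 ord0).
  by rewrite !mxE eqxx !mulr1n => /val_inj.
apply: (scalar_local_criterion (f := f) dn) => phi f0.
exact: fixed_unit f0 (fP phi).
Qed.

End CoverSum.

Theorem theorem5p2 (k : closedFieldType) (R : falgType k) (gT : finGroupType)
  (tau : algaction gT R) (V : lmodType R) (t : nat)
  (P : lmodType R) (p : {linear P -> V})
  (G_abelian : abelian [set: gT])
  (G_pchar : [pchar k]^'.-nat #|gT|)
  (V_simple : simple_mod V)
  (V_twists : complete_simples (fun g : gT => twist tau g V))
  (V_dim : has_dim t.+1 (restr V))
  (P_cover : projective_cover p) :
  let P_neq0 := projective_cover_neq0 V_simple P_cover in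
  let S := basic_alg tau P_neq0 in
  let S1 := fixalg (basic_action tau P_neq0) in
  [/\ alg_iso R (matalg S t),
      scalar_local S1
    & exists alpha : algaction gT S1,
        [/\ alg_iso S (skew_group alpha),
            alg_iso R (matalg (skew_group alpha) t)
          & exists beta : algaction gT (matalg S1 t),
              alg_iso (matalg (skew_group alpha) t) (skew_group beta)]].
Proof.
move=> P_neq0 S S1.
have RS : alg_iso R (matalg S t) by exact: cover_matalg.
split=> //; first exact: (fixed_scalar_local V_simple V_twists V_dim P_cover).
have cardG : (#|gT|%:R : k) != 0 by rewrite natf_neq0_pchar.
have [alpha Salpha] :=
  sum_idempotents_skew_group tau V_simple P_cover G_abelian cardG.
exists alpha; split=> //; first exact: alg_iso_trans RS (matalg_iso t Salpha).
exists (mat_action t alpha); exact: matalg_skew_group.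
Qed.
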